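(* Consider the message passing model on a connected undirected graph $G=(V,E)$ with $m$ vertices and diameter $d$, where the $i$-th player is given as input $X_i \in \mathbb{Z}^n_{\geq 0}$ (with entries at most $M$) and $\mathcal{X} = \sum_{i=1}^m X_i$. Let $\epsilon \in (0,1)$. Then there is a communication protocol which outputs an estimate $\tilde{\mathcal{X}} \in \mathbb{R}^n$ of $\mathcal{X}$ such that \[ \|\tilde{\mathcal{X}} - \mathcal{X}\|_\infty \leq \epsilon \|\mathcal{X}_{\mathrm{tail}(1/\epsilon^2)}\|_2 \] with probability $1-1/n^c$, for any constant $c \geq 1$. The protocol uses $O\!\left(\frac{m}{\epsilon^2}\log(n)(\log\log n + \log d + \log(1/\epsilon))\right)$ total communication and a max communication of $O\!\left(\frac{1}{\epsilon^2}\log(n)(\log\log n + \log d + \log(1/\epsilon))\right)$.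
   Context: For a vector $\mathcal{X} \in \mathbb{R}^n$ and integer $k$, $\mathcal{X}_{\mathrm{tail}(k)}$ is the vector $\mathcal{X}$ with its $k$ largest (in absolute value) entries set to $0$. Message passing model: there are $m$ players, one at each vertex of a connected undirected graph $G$ known to all players; player $i$ receives only $X_i$; a player may send a message only to a neighbor in $G$, received only by that neighbor; the players share a public random string; at termination a pre-specified player holds the output. Total communication is the total number of bits sent; max communication is the maximum number of bits sent across any single edge. Standing assumption: $m, M = O(n^{c'})$ for a constant $c'$, so $\log(nmM)=O(\log n)$. *)

(* Defs.v *)
From HB Require Import structures.
From mathcomp Require Import all_boot all_order all_algebra.
From mathcomp Require Import all_classical all_reals all_analysis.

Set Implicit Arguments.
Unset Strict Implicit.
Unset Printing Implicit Defensive.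

Import Order.TTheory GRing.Theory Num.Theory.
Import numFieldNormedType.Exports.

Local Open Scope ring_scope.

Definition simple_graph (V : finType) (e : rel V) : Prop :=
  symmetric e /\ irreflexive e.

Definition connected_graph (V : finType) (e : rel V) : Prop :=
  forall x y : V, connect e x y.

Definition has_walk (V : finType) (e : rel V) (x y : V) (k : nat) : bool :=
  [exists p : k.-tuple V, path e x p && (last x p == y)].

(* The least length of a walk from x to y; the value is #|V| when there is
   none, which does not occur in a connected graph. *)
Definition gdist (V : finType) (e : rel V) (x y : V) : nat :=
  find (has_walk e x y) (iota 0 #|V|).

Definition diameter (V : finType) (e : rel V) : nat :=
  (\max_(x : V) \max_(y : V) gdist e x y)%N.

(* Deterministic players with a public random string, on an asynchronous
   network whose links are FIFO in each direction.  [send v x w h u] is the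
   string of all the bits that v has emitted towards u, when v has input x,
   the public string is w and [h u'] are the bits v has received from u' so
   far.  Monotonicity for the prefix order says that an emitted bit cannot be
   withdrawn.  It also implies that a player can react neither to timing nor
   to silence, so that bits actually sent are the only means of communication
   between players. *)
Record protocol (R : realType) (V : finType) (n : nat) := Protocol {
  nrand : nat;
  send : V -> 'rV[nat]_n -> nrand.-tuple bool -> (V -> seq bool) ->
         V -> seq bool;
  send_mono : forall v x w (h h' : V -> seq bool),
    (forall u, prefix (h u) (h' u)) ->
    forall u, prefix (send v x w h u) (send v x w h' u);
  output : V -> 'rV[nat]_n -> nrand.-tuple bool -> (V -> seq bool) -> 'rV[R]_n
}.

Section Execution.
Variables (R : realType) (V : finType) (n : nat).
Variables (e : rel V) (P : protocol R V n).
Variables (X : V -> 'rV[nat]_n) (w : (nrand P).-tuple bool).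

(* [sent t u v]: the bits sent from u to v when all players have been activated
   t times in parallel.  Since [send] is monotone, every fair activation order
   leads to the same final strings, so nothing depends on the choice of the
   parallel one. *)
Fixpoint sent (t : nat) : V -> V -> seq bool :=
  if t is t'.+1 then
    fun u v => if e u v then send u (X u) w (fun x => sent t' x u) v else [::]
  else fun _ _ => [::].

Definition terminated (t : nat) : Prop :=
  forall u v, sent t.+1 u v = sent t u v.

Definition result (t : nat) (v : V) : 'rV[R]_n :=
  output v (X v) w (fun x => sent t x v).

Definition total_comm (t : nat) : nat :=
  (\sum_(u : V) \sum_(v : V) size (sent t u v))%N.

(* The bits sent across an edge, counting both directions. *)
Definition max_comm (t : nat) : nat :=
  (\max_(u : V) \max_(v : V | e u v) (size (sent t u v) + size (sent t v u)))%N.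

End Execution.

Arguments sent {R V n} e P X w t u v.
Arguments terminated {R V n} e P X w t.
Arguments result {R V n} e P X w t v.
Arguments total_comm {R V n} e P X w t.
Arguments max_comm {R V n} e P X w t.

(* Probability of an event under r independent fair bits. *)
Definition prob_bits (R : realType) (r : nat) (A : pred (r.-tuple bool)) : R :=
  #|A|%:R / (2 ^ r)%:R.

Definition l2norm (R : realType) (n : nat) (x : 'rV[R]_n) : R :=
  Num.sqrt (\sum_(j < n) x 0 j ^+ 2).

(* x with its k largest entries in absolute value set to 0; ties are broken
   towards smaller indices, which does not affect the norm. *)
Definition tail (R : realType) (n k : nat) (x : 'rV[R]_n) : 'rV[R]_n :=
  let largest := take k (sort (fun i j => `|x 0 j| <= `|x 0 i|) (enum 'I_n)) in
  \row_(j < n) (if j \in largest then 0 else x 0 j).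

Definition total_input (R : realType) (V : finType) (n : nat)
    (X : V -> 'rV[nat]_n) : 'rV[R]_n :=
  map_mx (fun k : nat => k%:R) (\sum_(v : V) X v).

(* log d is 0 by convention when d = 0, i.e. for the one-vertex graph. *)
Definition edge_bound (R : realType) (n d : nat) (eps : R) : R :=
  eps ^- 2 * ln n%:R * (ln (ln n%:R) + ln d%:R + ln eps^-1).

(* Main.v *)
Require Import Defs.
From HB Require Import structures.
From mathcomp Require Import all_boot all_order all_algebra.
From mathcomp Require Import all_classical all_reals all_analysis.
From mathcomp Require Import zify ring lra.

(* The players convergecast a count-sketch along a breadth-first tree, whose
   depth is at most the diameter.  A partial sum of a bucket is rounded without
   bias to a float with s mantissa bits, so one bucket costs s bits plus the
   size of an exponent, logarithmic in the depth and doubly logarithmic in the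
   entries.  Random signs bound the second moment of a partial sum by the
   squared norm of the bucket.  The inputs are nonnegative, so the squared norms
   of the children of a node add up to at most that of the node, and the
   rounding variance grows by a factor of only 1 + 4^-s per level.

   The rounding noise of a bucket is relative to that bucket alone, so the
   estimate of a coordinate i has error at most (eps/4) tail + (eps/8) x_i as
   soon as i is separated from the k = ceil(1/eps^2) largest coordinates.  The
   term in x_i is not controlled by the tail, and one sweep does not suffice:
   even a one-sparse input has to be recovered exactly.  So the root broadcasts
   the k largest estimates, and a second convergecast returns the exact sums of
   these coordinates.  Every other coordinate is at most twice the tail norm:
   otherwise it would be among the k largest ones, and some coordinate of the
   tail would have been broadcast in its place, with a larger estimate. *)

Set Implicit Arguments.
Unset Strict Implicit.
Unset Printing Implicit Defensive.

Import Order.TTheory GRing.Theory Num.Theory.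
Import numFieldNormedType.Exports.

Local Open Scope ring_scope.

(** * Breadth-first trees *)

Section BreadthFirstTree.
Variables (V : finType) (e : rel V).

Lemma has_walkP x y k :
  reflect (exists p, [/\ size p = k, path e x p & last x p = y])
          (has_walk e x y k).
Proof.
apply: (iffP existsP) => [[p /andP[ep /eqP lp]]|[p [sp ep lp]]].
  by exists p; rewrite size_tuple.
have sp' : size p == k by rewrite sp.
by exists (Tuple sp'); rewrite /= ep lp eqxx.
Qed.

Lemma gdist_le x y k : has_walk e x y k -> (gdist e x y <= k)%N.
Proof.
move=> xyk; rewrite leqNgt; apply/negP => lt_k.
have kV : (k < #|V|)%N.
  by rewrite (leq_trans lt_k)// (leq_trans (find_size _ _))// size_iota.
by have := before_find 0%N lt_k; rewrite nth_iota// add0n xyk.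
Qed.

(** A walk shortens to one without repeated vertices, of length below [#|V|], so the search in
    [gdist] does not end in its default value. *)
Lemma gdist_walk x y : connect e x y -> has_walk e x y (gdist e x y).
Proof.
case/connectP => p ep ->; case/shortenP: ep => q eq uq _.
have sq : (size q < #|V|)%N.
  by have := max_card [in x :: q]; rewrite (card_uniqP uq).
have ex : has (has_walk e x (last x q)) (iota 0 #|V|).
  apply/hasP; exists (size q); first by rewrite mem_iota.
  by apply/has_walkP; exists q.
have := nth_find 0%N ex; rewrite nth_iota ?add0n//.
by rewrite -[X in (_ < X)%N](size_iota 0) -has_find.
Qed.

Lemma gdistxx x : gdist e x x = 0%N.
Proof. by apply/eqP; rewrite -leqn0 gdist_le//; apply/has_walkP; exists [::]. Qed.

Lemma gdist_diameter x y : (gdist e x y <= diameter e)%N.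
Proof.
by rewrite /diameter (bigD1 x)//= (bigD1 y)//= !leq_max leqnn.
Qed.

(** The parent is the last vertex but one on a shortest walk from the root; [par root] is
    arbitrary. *)
Lemma bfs_tree (root : V) : symmetric e -> connected_graph e ->
  exists par : V -> V, forall v, v != root ->
    e v (par v) /\ gdist e root v = (gdist e root (par v)).+1.
Proof.
move=> sym_e con_e.
suff H v : v != root ->
    exists u, e v u /\ gdist e root v = (gdist e root u).+1.
  have [par parP] := choice (fun v =>
     match pselect (v != root) with
     | left vr => let: ex_intro u Hu := H v vr in ex_intro
        (fun u => v != root -> e v u /\ gdist e root v = (gdist e root u).+1)
        u (fun _ => Hu)
     | right nvr => ex_intro
        (fun u => v != root -> e v u /\ gdist e root v = (gdist e root u).+1)
        v (fun vr => False_ind _ (nvr vr))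
     end).
  by exists par.
move=> vr; have /has_walkP[p [sp ep lp]] := gdist_walk (con_e root v).
case/lastP: p => [|p z] in sp ep lp *; first by rewrite -lp eqxx in vr.
rewrite last_rcons in lp; subst z.
move: ep; rewrite rcons_path => /andP[ep euv].
exists (last root p); split; first by rewrite sym_e.
apply/eqP; rewrite eqn_leq -{2}sp size_rcons ltnS; apply/andP; split.
  have /has_walkP[q [sq eq lq]] := gdist_walk (con_e root (last root p)).
  apply: gdist_le; apply/has_walkP; exists (rcons q v).
  by rewrite size_rcons sq last_rcons rcons_path eq lq euv.
by apply: gdist_le; apply/has_walkP; exists p.
Qed.

End BreadthFirstTree.

(** * Rooted trees given by parent pointers *)

Definition child (V : finType) (root : V) (par : V -> V) (v c : V) : bool :=
  (c != root) && (par c == v).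

Lemma child_par (V : finType) (root : V) (par : V -> V) c :
  c != root -> child root par (par c) c.
Proof. by rewrite /child eqxx andbT. Qed.

Section RootedTree.
Variables (V : finType) (root : V) (par : V -> V) (dep : V -> nat) (d : nat).
Hypothesis dep_par : forall v, v != root -> dep v = (dep (par v)).+1.
Hypothesis dep_le : forall v, (dep v <= d)%N.

Local Notation child := (child root par).

Lemma dep_child v c : child v c -> dep c = (dep v).+1.
Proof. by case/andP=> cr /eqP <-; exact: dep_par. Qed.

(** Depth increases towards the children and is at most [d], so [d - dep v] is a decreasing
    measure. *)
Lemma tree_ind (P : V -> Prop) :
  (forall v, (forall c, child v c -> P c) -> P v) -> forall v, P v.
Proof.
move=> H v; have [k] := ubnP (d - dep v).
elim: k v => // k IH v; rewrite ltnS => le_k.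
apply: H => c vc; apply: IH; apply: leq_trans le_k.
by rewrite ltn_sub2l// -(dep_child vc).
Qed.

(** Iterating [g] settles the value at [v] after [d - dep v + 1] rounds. *)
Lemma tree_fix (F : Type) (m0 : V -> F) (g : V -> (V -> F) -> F) :
  (forall v m m', (forall c, child v c -> m c = m' c) -> g v m = g v m') ->
  exists m : V -> F, forall v, m v = g v m.
Proof.
move=> gloc; pose mk k := iter k (fun m v => g v m) m0.
have stable k v : (d - dep v < k)%N -> mk k v = mk k.+1 v.
  elim: k v => // k IH v; rewrite ltnS => le_k.
  apply: gloc => c vc; apply: IH; apply: leq_trans le_k.
  by rewrite ltn_sub2l// -(dep_child vc).
by exists (mk d.+1) => v; rewrite stable// ltnS leq_subr.
Qed.

Lemma tree_uniq (F : Type) (g : V -> (V -> F) -> F) (m m' : V -> F) :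
  (forall v m m', (forall c, child v c -> m c = m' c) -> g v m = g v m') ->
  (forall v, m v = g v m) -> (forall v, m' v = g v m') -> m =1 m'.
Proof.
move=> gloc mE m'E; apply: tree_ind => v IH.
by rewrite mE m'E; exact: gloc.
Qed.

(** Telescoping: each [f c] with [c != root] occurs once for [c] itself and once, negated, among the
    children of [par c]. *)
Lemma tree_sum (A : zmodType) (a f : V -> A) :
  (forall v, f v = a v + \sum_(c | child v c) f c) ->
  f root = \sum_v a v.
Proof.
move=> fE; have aE v : a v = f v - \sum_(c | child v c) f c.
  by rewrite fE addrK.
under eq_bigr do rewrite aE.
rewrite sumrB (exchange_big_dep (fun c => c != root))/=; last first.
  by move=> i j _ /andP[].
rewrite (bigD1 root)//= -addrA -[LHS]addr0; congr (_ + _).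
apply/esym/eqP; rewrite subr_eq0; apply/eqP/eq_bigr => c cr.
rewrite (bigD1 (par c))/=; last exact: child_par.
by rewrite big1 ?addr0// => i /andP[/andP[_ /eqP ->]]; rewrite eqxx.
Qed.

End RootedTree.

(** * Protocols on trees *)

Lemma card_bij (A B : finType) : #|A| = #|B| -> exists f : A -> B, bijective f.
Proof.
move=> eqAB; exists (fun x => enum_val (cast_ord eqAB (enum_rank x))).
exists (fun y => enum_val (cast_ord (esym eqAB) (enum_rank y))) => x.
  by rewrite enum_valK cast_ordK enum_rankK.
by rewrite enum_valK cast_ordKV enum_rankK.
Qed.

Section BitEncoding.
Variables (F : finType) (L : nat) (x0 : F).

(** All codes have length [L], so that blocks of a concatenation can be cut out by position. *)
Definition to_bits (x : F) : seq bool :=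
  nth [tuple of nseq L false] (enum {:L.-tuple bool}) (enum_rank x).

Definition of_bits (s : seq bool) : F := odflt x0 [pick x | to_bits x == s].

Lemma size_to_bits x : size (to_bits x) = L.
Proof. by rewrite size_tuple. Qed.

Lemma to_bitsK : (#|F| <= 2 ^ L)%N -> cancel to_bits of_bits.
Proof.
move=> leF x; rewrite /of_bits; case: pickP => [y /= /eqP/val_inj/eqP|/(_ x)].
  rewrite nth_uniq ?enum_uniq//.
  - by move/eqP/val_inj/enum_rank_inj.
  - by rewrite -cardE card_tuple card_bool (leq_trans (ltn_ord _)).
  - by rewrite -cardE card_tuple card_bool (leq_trans (ltn_ord _)).
by rewrite eqxx.
Qed.

End BitEncoding.

Lemma prefix_take_eq (T : eqType) L (s s' : seq T) :
  prefix s s' -> (L <= size s)%N -> take L s' = take L s.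
Proof. by move=> /prefixP[t ->] Ls; rewrite takel_cat. Qed.

Lemma prefix_take_mono (T : eqType) L (s s' : seq T) :
  prefix s s' -> prefix (take L s) (take L s').
Proof.
move=> /prefixP[t ->]; rewrite take_cat; case: ltnP => Ls; first exact: prefix_refl.
by rewrite take_oversize// prefix_prefix.
Qed.

Lemma prefix_size_eq (T : eqType) (s s' : seq T) :
  prefix s s' -> size s' = size s -> s' = s.
Proof.
move=> /prefixP[t ->] /eqP; rewrite size_cat -[X in _ == X]addn0 eqn_add2l.
by rewrite size_eq0 => /eqP ->; rewrite cats0.
Qed.

(** * Executions of monotone protocols *)

Section Execution.
Variables (R : realType) (V : finType) (n : nat) (e : rel V) (P : protocol R V n).
Variables (X : V -> 'rV[nat]_n) (w : (nrand P).-tuple bool).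

Lemma sent_mono t u v : prefix (sent e P X w t u v) (sent e P X w t.+1 u v).
Proof.
elim: t u v => [|t IH] u v; first exact: prefix0s.
rewrite /=; case: ifP => // _; apply: send_mono => x; exact: IH.
Qed.

Lemma terminatedS t : terminated e P X w t -> terminated e P X w t.+1.
Proof.
move=> Ht u v; rewrite /= ; case: ifP => // _.
by congr (send _ _ _ _); apply/funext => x; have := Ht x u.
Qed.

(* Every round in which some string grows adds at least one bit to the total. *)
Lemma terminated_bound (b : nat) :
  (forall t, total_comm e P X w t <= b)%N -> terminated e P X w b.+1.
Proof.
move=> leb.
suff H t : terminated e P X w t \/ (t <= total_comm e P X w t)%N.
  by have [//|/leq_trans/(_ (leb _))] := H b.+1; rewrite ltnn.
elim: t => [|t [IH|IH]]; [by right|by left; exact: terminatedS|].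
have [Ht|Ht] := pselect (terminated e P X w t); first by left; exact: terminatedS.
right; apply: leq_ltn_trans IH _; rewrite ltnNge; apply/negP => le_t; apply: Ht.
have le1 u v : (size (sent e P X w t u v) <= size (sent e P X w t.+1 u v))%N.
  exact/size_prefix/sent_mono.
have le2 u : (\sum_v size (sent e P X w t u v)
              <= \sum_v size (sent e P X w t.+1 u v))%N.
  exact: leq_sum.
have eq2 u : (\sum_v size (sent e P X w t.+1 u v))%N
           = (\sum_v size (sent e P X w t u v))%N.
  apply/eqP; rewrite eqn_leq le2 andbT leqNgt; apply/negP => lt_u.
  move: le_t; rewrite leqNgt => /negP; apply; rewrite /total_comm.
  rewrite (bigD1 u)//= [ltnRHS](bigD1 u)//= -addSn leq_add//.
  by apply: leq_sum => i _; exact: le2.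
move=> u v; apply: prefix_size_eq; first exact: sent_mono.
apply/eqP; rewrite eqn_leq le1 andbT leqNgt; apply/negP => lt_uv.
suff : (\sum_v size (sent e P X w t u v) < \sum_v size (sent e P X w t.+1 u v))%N.
  by rewrite eq2 ltnn.
rewrite (bigD1 v)//= [ltnRHS](bigD1 v)//= -addSn leq_add//.
by apply: leq_sum => i _; exact: le1.
Qed.

End Execution.

(** * A tree protocol with an upward, a downward and a second upward sweep *)

Section TreeProtocol.
Variables (R : realType) (V : finType) (n : nat) (e : rel V).
Variables (root : V) (par : V -> V) (dep : V -> nat) (d : nat).
Hypothesis sym_e : symmetric e.
Hypothesis e_par : forall v, v != root -> e v (par v).
Hypothesis dep_par : forall v, v != root -> dep v = (dep (par v)).+1.
Hypothesis dep_le : forall v, (dep v <= d)%N.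
Variables (Omega F1 F2 F3 : finType) (N L1 L2 L3 : nat).
Hypothesis card_Omega : #|Omega| = (2 ^ N)%N.
Hypothesis card_F1 : (#|F1| <= 2 ^ L1)%N.
Hypothesis card_F2 : (#|F2| <= 2 ^ L2)%N.
Hypothesis card_F3 : (#|F3| <= 2 ^ L3)%N.
Variables (x1 : F1) (x2 : F2) (x3 : F3).
Variable g1 : Omega -> V -> 'rV[nat]_n -> (V -> F1) -> F1.
Variable g2 : Omega -> F1 -> F2.
Variable g3 : F2 -> V -> 'rV[nat]_n -> (V -> F3) -> F3.
Variable out : Omega -> F1 -> F3 -> 'rV[R]_n.

Local Notation child := (child root par).

Hypothesis g1_local : forall om v x m m',
  (forall c, child v c -> m c = m' c) -> g1 om v x m = g1 om v x m'.
Hypothesis g3_local : forall H v x m m',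
  (forall c, child v c -> m c = m' c) -> g3 H v x m = g3 H v x m'.

Let dec1 := of_bits L1 x1.
Let dec2 := of_bits L2 x2.
Let dec3 := of_bits L3 x3.

(* The string sent to the parent is an F1-block followed by an F3-block; the
   string sent to a child is a single F2-block, which inner nodes stream on
   from their parent.  In a terminated state the strings satisfy the fixpoint
   equation of [tree_send], from which the blocks are read off by induction on
   the depth. *)
Let ready L v (h : V -> seq bool) := [forall c, child v c ==> (L <= size (h c))%N].
Let in1 (h : V -> seq bool) c := dec1 (take L1 (h c)).
Let in3 (h : V -> seq bool) c := dec3 (drop L1 (take (L1 + L3) (h c))).
Let up1 om v x h :=
  if ready L1 v h then to_bits L1 (g1 om v x (in1 h)) else [::].
Let down om v x (h : V -> seq bool) :=
  if v == root then
    if ready L1 v h then to_bits L2 (g2 om (g1 om v x (in1 h))) else [::]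
  else take L2 (h (par v)).
Let up2 om v x h :=
  if ready (L1 + L3) v h && (L2 <= size (down om v x h))%N
  then to_bits L3 (g3 (dec2 (down om v x h)) v x (in3 h)) else [::].
Let tree_send om v x h u :=
  if (v != root) && (u == par v) then up1 om v x h ++ up2 om v x h
  else if child v u then down om v x h else [::].
Let tree_out om x h :=
  out om (g1 om root x (in1 h)) (g3 (dec2 (down om root x h)) root x (in3 h)).

Let ready_mono L v h h' : (forall u, prefix (h u) (h' u)) ->
  ready L v h -> ready L v h'.
Proof.
move=> hh' /forallP rh; apply/forallP => c; apply/implyP => vc.
by have := rh c; rewrite vc => /leq_trans; apply; exact/size_prefix/hh'.
Qed.

Let in1_eq om v x h h' : (forall u, prefix (h u) (h' u)) -> ready L1 v h ->
  g1 om v x (in1 h') = g1 om v x (in1 h).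
Proof.
move=> hh' /forallP rh; apply: g1_local => c vc; rewrite /in1.
by have := rh c; rewrite vc => /= /(prefix_take_eq (hh' c)) ->.
Qed.

Let in3_eq H v x h h' : (forall u, prefix (h u) (h' u)) -> ready (L1 + L3) v h ->
  g3 H v x (in3 h') = g3 H v x (in3 h).
Proof.
move=> hh' /forallP rh; apply: g3_local => c vc; rewrite /in3.
by have := rh c; rewrite vc => /= /(prefix_take_eq (hh' c)) ->.
Qed.

Let down_size om v x h : (size (down om v x h) <= L2)%N.
Proof.
rewrite /down; case: ifP => _; first by case: ifP => _; rewrite ?size_to_bits.
by rewrite size_take_min geq_minl.
Qed.

Let down_mono om v x h h' : (forall u, prefix (h u) (h' u)) ->
  prefix (down om v x h) (down om v x h').
Proof.
move=> hh'; rewrite /down; case: ifP => _; last exact: prefix_take_mono.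
case: ifP => r1; last exact: prefix0s.
by rewrite (ready_mono hh' r1) (in1_eq _ _ hh' r1) prefix_refl.
Qed.

Let readyS v h : ready (L1 + L3) v h -> ready L1 v h.
Proof.
move=> /forallP rh; apply/forallP => c; apply/implyP => vc.
by have := rh c; rewrite vc => /=; apply: leq_trans; exact: leq_addr.
Qed.

Let tree_send_mono om v x h h' : (forall u, prefix (h u) (h' u)) ->
  forall u, prefix (tree_send om v x h u) (tree_send om v x h' u).
Proof.
move=> hh' u; rewrite /tree_send; case: ifP => _; last first.
  by case: ifP => // _; exact: down_mono.
rewrite /up1 /up2; case: ifP => r1; last first.
  (* [up2] waits for both blocks of every child, so it is never emitted while [up1] is empty. *)
  case: ifP => [/andP[r3 _]|_]; [by rewrite (readyS r3) in r1|exact: prefix0s].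
rewrite (ready_mono hh' r1) (in1_eq _ _ hh' r1) prefix_catr ?eqxx//=.
case: ifP => [/andP[r3 s2]|_]; last exact: prefix0s.
rewrite (ready_mono hh' r3) (in3_eq _ _ hh' r3).
(* [down] already has its maximal length [L2], so further input cannot extend it. *)
have -> : down om v x h' = down om v x h.
  apply: (prefix_size_eq (down_mono om v x hh')); apply/eqP.
  rewrite eqn_leq (leq_trans _ s2)//=.
  exact/size_prefix/down_mono.
by rewrite s2 prefix_refl.
Qed.

Lemma tree_protocol : exists (P : protocol R V n) (T : nat)
    (rho : (nrand P).-tuple bool -> Omega),
  bijective rho /\ forall X w,
  [/\ terminated e P X w T,
      exists m1 m3, [/\ forall v, m1 v = g1 (rho w) v (X v) m1,
        forall v, m3 v = g3 (g2 (rho w) (m1 root)) v (X v) m3 &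
        result e P X w T root = out (rho w) (m1 root) (m3 root)],
      (total_comm e P X w T <= #|V| * (L1 + L2 + L3))%N &
      (max_comm e P X w T <= L1 + L2 + L3)%N].
Proof.
have [rho rho_bij] : exists rho : N.-tuple bool -> Omega, bijective rho.
  by apply: card_bij; rewrite card_tuple card_bool card_Omega.
pose P := @Protocol R V n N (fun v x w => tree_send (rho w) v x)
  (fun v x w => tree_send_mono (rho w) v x)
  (fun v x w => tree_out (rho w) x).
have size_sent X w t u v : (size (sent e P X w t u v) <=
    ((u != root) && (v == par u)) * (L1 + L3)
    + ((v != root) && (u == par v)) * L2)%N.
  case: t => [//|t] /=; case: ifP => // _; rewrite /tree_send.
  case: ifP => [_|_].
    rewrite mul1n (leq_trans _ (leq_addr _ _))// size_cat leq_add//.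
      by rewrite /up1; case: ifP => _; rewrite ?size_to_bits.
    by rewrite /up2; case: ifP => _; rewrite ?size_to_bits.
  rewrite /child (eq_sym u).
  by case: ifP => // _; rewrite mul1n mul0n; exact: down_size.
have total X w t : (total_comm e P X w t <= #|V| * (L1 + L2 + L3))%N.
  rewrite /total_comm.
  apply: (@leq_trans (\sum_u \sum_v (((u != root) && (v == par u)) * (L1 + L3)
    + ((v != root) && (u == par v)) * L2)))%N.
    by apply: leq_sum => u _; apply: leq_sum => v _; exact: size_sent.
  under eq_bigr do rewrite big_split.
  rewrite big_split/= addnAC mulnDr leq_add//.
    rewrite -sum_nat_const leq_sum// => u _.
    rewrite (bigD1 (par u))//= eqxx andbT big1 ?addn0; last first.
      by move=> v /negPf ->; rewrite andbF.
    by case: (u == root); rewrite ?mul1n.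
  rewrite exchange_big -sum_nat_const/= leq_sum// => u _.
  rewrite (bigD1 (par u))//= eqxx andbT big1 ?addn0; last first.
    by move=> v /negPf ->; rewrite andbF.
  by case: (u == root); rewrite ?mul1n.
have maxc X w t : (max_comm e P X w t <= L1 + L2 + L3)%N.
  apply/bigmax_leqP => u _; apply/bigmax_leqP => v _.
  apply: leq_trans (leq_add (size_sent _ _ _ _ _) (size_sent _ _ _ _ _)) _.
  (* Two vertices are not each other's parent, since depths would differ; so an edge carries each
     kind of block at most once. *)
  have : ~~ (((u != root) && (v == par u)) && ((v != root) && (u == par v))).
    apply/negP => /andP[/andP[ur /eqP vu] /andP[vr /eqP uv]].
    have := dep_par ur; rewrite -vu (dep_par vr) -uv => /esym/eqP.
    by rewrite -{2}[dep u]addn0 -addn2 eqn_add2l.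
  case: ((u != root) && _); case: ((v != root) && _) => //= _;
    lia.
(* The time bound comes from the bound on the bits sent, hence is the same for all inputs and random
   strings. *)
exists P, (#|V| * (L1 + L2 + L3)).+1, rho; split=> // X w.
have Ht : terminated e P X w (#|V| * (L1 + L2 + L3)).+1.
  exact: terminated_bound.
split=> //; move: (#|V| * (L1 + L2 + L3)).+1 Ht => T Ht.
pose om := rho w; pose S := sent e P X w T; pose h v c := S c v.
have SE u v : e u v -> S u v = tree_send om u (X u) (h u) v.
  by move=> euv; rewrite /S -Ht /= euv.
have S_up c : c != root ->
    S c (par c) = up1 om c (X c) (h c) ++ up2 om c (X c) (h c).
  by move=> cr; rewrite SE ?e_par// /tree_send cr eqxx.
have S_down c : c != root -> S (par c) c = down om (par c) (X (par c)) (h (par c)).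
  move=> cr; rewrite SE; last by rewrite sym_e e_par.
  rewrite /tree_send child_par// ifF//; apply/negP => /andP[pr /eqP cE].
  have := dep_par cr; rewrite (dep_par pr) -cE => /eqP.
  by rewrite -{1}[dep c]addn0 -addn2 eqn_add2l.
have S_up' v c : child v c -> h v c = up1 om c (X c) (h c) ++ up2 om c (X c) (h c).
  by move=> /andP[cr /eqP <-]; exact: S_up.
have r1 v : ready L1 v (h v).
  move: v; apply: (tree_ind dep_par dep_le) => v IH.
  apply/forallP => c; apply/implyP => vc.
  by rewrite (S_up' _ _ vc) size_cat /up1 IH// size_to_bits leq_addr.
pose m1 v := g1 om v (X v) (in1 (h v)).
have m1E v : m1 v = g1 om v (X v) m1.
  apply: g1_local => c vc; rewrite /in1 (S_up' _ _ vc) /up1 r1.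
  by rewrite take_cat size_to_bits ltnn subnn take0 cats0 /dec1 to_bitsK.
have dE v : down om v (X v) (h v) = to_bits L2 (g2 om (m1 root)).
  have [k] := ubnP (dep v); elim: k v => // k IH v; rewrite ltnS => vk.
  rewrite /down; have [->|vr] := eqVneq v root; first by rewrite r1.
  rewrite /h S_down// IH; last by rewrite -(dep_par vr).
  by rewrite take_oversize// size_to_bits.
pose H := g2 om (m1 root).
have dE' v : dec2 (down om v (X v) (h v)) = H by rewrite dE /dec2 to_bitsK.
have r3 v : ready (L1 + L3) v (h v).
  move: v; apply: (tree_ind dep_par dep_le) => v IH.
  apply/forallP => c; apply/implyP => vc.
  by rewrite (S_up' _ _ vc) size_cat /up1 r1 /up2 IH// dE
    !size_to_bits leqnn size_to_bits leqnn.
pose m3 v := g3 H v (X v) (in3 (h v)).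
have m3E v : m3 v = g3 H v (X v) m3.
  apply: g3_local => c vc; rewrite /in3 (S_up' _ _ vc) /up1 r1 /up2 r3 dE'.
  rewrite dE size_to_bits leqnn take_oversize ?size_cat ?size_to_bits//.
  by rewrite drop_cat size_to_bits ltnn subnn drop0 /dec3 to_bitsK.
exists m1, m3; split=> //.
by rewrite /result /= /tree_out -/om -/S -/(h root) dE'.
Qed.

End TreeProtocol.

(** * Averages over finite types *)

Definition mean (R : realFieldType) (T : finType) (f : T -> R) : R :=
  (\sum_x f x) / #|T|%:R.

Section Mean.
Variables (R : realFieldType).
Implicit Types T : finType.

Lemma eq_mean T (f g : T -> R) : f =1 g -> mean f = mean g.
Proof. by move=> fg; rewrite /mean (eq_bigr g). Qed.

Lemma mean_le T (f g : T -> R) : (forall x, f x <= g x) -> mean f <= mean g.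
Proof. by move=> fg; rewrite /mean ler_wpM2r ?invr_ge0// ler_sum. Qed.

Lemma mean_ge0 T (f : T -> R) : (forall x, 0 <= f x) -> 0 <= mean f.
Proof. by move=> fg; rewrite divr_ge0// sumr_ge0. Qed.

Lemma meanD T (f g : T -> R) : mean (fun x => f x + g x) = mean f + mean g.
Proof. by rewrite /mean big_split mulrDl. Qed.

Lemma meanZ T c (f : T -> R) : mean (fun x => c * f x) = c * mean f.
Proof. by rewrite /mean -mulr_sumr mulrA. Qed.

Lemma mean_sum T (I : finType) (P : pred I) (f : I -> T -> R) :
  mean (fun x => \sum_(i | P i) f i x) = \sum_(i | P i) mean (f i).
Proof. by rewrite /mean exchange_big -mulr_suml. Qed.

Lemma mean_cst T c : (0 < #|T|)%N -> mean (fun _ : T => c) = c :> R.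
Proof.
move=> T0; have -> : mean (fun _ : T => c) = c * #|T|%:R / #|T|%:R.
  by rewrite /mean sumr_const mulr_natr.
by rewrite mulfK// pnatr_eq0 -lt0n.
Qed.

Lemma mean_pair T1 T2 (f : T1 * T2 -> R) :
  mean f = mean (fun x => mean (fun y => f (x, y))).
Proof.
rewrite /mean -mulr_suml card_prod natrM invfM mulrA pair_bigA/= mulrAC.
by congr (_ / _ / _); apply: eq_bigr => -[].
Qed.

Lemma mean_bij T1 T2 (h : T1 -> T2) (f : T2 -> R) : bijective h ->
  mean (fun x => f (h x)) = mean f.
Proof.
move=> bh; rewrite /mean (bij_eq_card bh); congr (_ / _).
by rewrite (reindex h)//; exact: onW_bij.
Qed.

Lemma mean_indicator T (P : pred T) :
  mean (fun x => (P x)%:R) = #|P|%:R / #|T|%:R :> R.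
Proof.
by rewrite /mean -natr_sum; congr (_%:R / _); rewrite -sum1_card -big_mkcond.
Qed.

(** The product form [mu * t] covers the threshold [t = 0], where [f] must vanish identically. *)
Lemma markov_mean T (f : T -> R) (t mu : R) : (forall x, 0 <= f x) ->
  0 <= t -> mean f <= mu * t -> 0 <= mu ->
  mean (fun x => (t < f x)%R%:R) <= mu.
Proof.
move=> f0; rewrite le_eqVlt => /predU1P[<-|t0] le_mu mu0; last first.
  rewrite -(ler_pM2r t0); apply: le_trans le_mu.
  rewrite mulrC -meanZ; apply: mean_le => x.
  by case: ltP => [/ltW|]; rewrite ?mulr1 ?mulr0.
rewrite mulr0 in le_mu; apply: le_trans mu0.
suff f_eq0 x : f x = 0.
  by apply: le_trans le_mu; apply: mean_le => x; rewrite f_eq0 ltxx.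
apply/eqP; rewrite eq_le f0 andbT.
have T0 : (0 < #|T|)%N by apply/card_gt0P; exists x.
move: le_mu; rewrite /mean pmulr_lle0 ?invr_gt0 ?ltr0n//.
by apply: le_trans; rewrite (bigD1 x)//= lerDl sumr_ge0.
Qed.

Section FunctionUpdate.
Variables D C : finType.

Definition upd (f : {ffun D -> C}) (i : D) (c : C) : {ffun D -> C} :=
  [ffun j => if j == i then c else f j].

Lemma upd_same f i c : upd f i c i = c.
Proof. by rewrite ffunE eqxx. Qed.

Lemma upd_neq f i c j : j != i -> upd f i c j = f j.
Proof. by move=> /negPf ji; rewrite ffunE ji. Qed.

(** Resampling one coordinate preserves the uniform distribution: exchanging the old value and the
    new one is an involution. The orthogonality arguments below rest on this. *)
Lemma mean_upd (F : {ffun D -> C} -> R) i : (0 < #|C|)%N ->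
  mean (fun f => mean (fun c => F (upd f i c))) = mean F.
Proof.
move=> C0; have -> : mean F = mean (fun p : {ffun D -> C} * C => F p.1).
  by rewrite mean_pair/=; apply: eq_mean => f; rewrite mean_cst.
rewrite -(mean_pair (fun p => F (upd p.1 i p.2))).
rewrite -(@mean_bij _ _ (fun p => (upd p.1 i p.2, p.1 i)) (fun p => F p.1))//.
apply: inv_bij => -[f c] /=; rewrite upd_same; congr (_, _).
by apply/ffunP => j; rewrite !ffunE; case: eqP => [->|].
Qed.

Lemma mean_prod (f : C -> R) :
  mean (fun om : {ffun D -> C} => \prod_i f (om i)) = mean f ^+ #|D|.
Proof.
rewrite /mean card_ffun natrX expr_div_n; congr (_ / _).
by rewrite -(bigA_distr_bigA (fun _ : D => f)) prodr_const.
Qed.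

End FunctionUpdate.

(* Markov's inequality for 16 ^ (number of bad coordinates), whose mean is a
   product over the coordinates. *)
Lemma majority_fails (T : finType) (bad : pred T) (r : nat) :
  mean (fun x => (bad x)%:R) <= 15^-1 :> R ->
  mean (fun om : {ffun 'I_r -> T} =>
          (r <= 2 * #|[pred i | bad (om i)]|)%N%:R) <= 2 ^- r :> R.
Proof.
(* For empty [T] the mean is 0 through division by 0, except when [r = 0], where the bound is 1. *)
move=> le_bad; have [T0|T0] := posnP #|T|.
  case: r => [|r].
    rewrite expr0 invr1 -[leRHS](@mean_cst {ffun 'I_0 -> T} 1).
      by apply: mean_le => om; rewrite lern1 leq_b1.
    by rewrite card_ffun card_ord T0.
  by rewrite /mean card_ffun card_ord T0 exp0n// invr0 mulr0 invr_ge0 exprn_ge0.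
apply: (@le_trans _ _ (4 ^- r * mean (fun om : {ffun 'I_r -> T} =>
    \prod_i (1 + 15 * (bad (om i))%:R)))).
  rewrite -meanZ; apply: mean_le => om.
  have -> : \prod_i (1 + 15 * (bad (om i))%:R) =
      16 ^+ #|[pred i | bad (om i)]| :> R.
    rewrite -prodr_const [RHS]big_mkcond/=; apply: eq_bigr => i _.
    by rewrite inE; case: (bad _);
      rewrite ?mulr0 ?addr0 ?mulr1 ?[1 + _]addrC -?natr1.
  case: leqP => [le_r|_]; last by rewrite mulr_ge0 ?invr_ge0 ?exprn_ge0.
  rewrite mulrC ler_pdivlMr ?exprn_gt0// mul1r.
  have -> : 16 = 4 ^+ 2 :> R by ring.
  by rewrite -exprM ler_weXn2l// ler1n.
(* Each factor has mean at most 1 + 15/15 = 2, and [2 ^ r / 4 ^ r = 2 ^- r]. *)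
rewrite (mean_prod _ (fun x => 1 + 15 * (bad x)%:R)) card_ord.
rewrite mulrC ler_pdivrMr ?exprn_gt0//.
have -> : 2 ^- r * 4 ^+ r = 2 ^+ r :> R.
  have -> : 4 = 2 * 2 :> R by ring.
  by rewrite exprMn mulKf// expf_neq0// pnatr_eq0.
apply: lerXn2r; rewrite ?nnegrE//.
  by apply: mean_ge0 => x; rewrite addr_ge0// mulr_ge0.
by rewrite meanD meanZ mean_cst//; lra.
Qed.

End Mean.

(** * Unbiased rounding *)

Section Rounding.
Variables s E : nat.

(* [x.1] is the exponent and [x.2] the signed mantissa, shifted to be
   nonnegative. *)
Definition float := ('I_E.+1 * 'I_(2 ^ (s + 3)).+1)%type.

Definition float_val (x : float) : int :=
  (2 ^ x.1)%N%:Z * (x.2%:Z - (2 ^ (s + 2))%N%:Z).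

(** Truncated subtraction gives exponent 0 when [|z| < 2 ^ s.+1]; such integers are stored
    exactly. *)
Definition round_exp (z : int) : nat := (trunc_log 2 `|z|%N - s)%N.

(* With D the unit of the last mantissa digit and r the remainder of z modulo D,
   the value is rounded up when [u < r * (2 ^ E / D)], that is, with probability
   r / D. *)
Definition float_round (z : int) (u : 'I_(2 ^ E)) : float :=
  let D := (2 ^ round_exp z)%N%:Z in
  let up : bool := (u < `|(z %% D)%Z|%N * 2 ^ (E - round_exp z))%N in
  (inord (round_exp z), inord (absz ((z %/ D)%Z + up%:Z + (2 ^ (s + 2))%N%:Z))).

Lemma card_float : (#|{: float}| <= E.+1 * 2 ^ (s + 4))%N.
Proof.
rewrite card_prod !card_ord leq_mul// addn3 addn4 [in leqRHS]expnS.
by have : (0 < 2 ^ s.+3)%N by [rewrite expn_gt0]; lia.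
Qed.

Lemma round_exp_le z : (`|z| < 2 ^ E)%N -> (round_exp z <= E)%N.
Proof.
move=> zE; rewrite /round_exp; have [->|z0] := posnP `|z|%N.
  by rewrite trunc_log0.
apply: leq_trans (leq_subr _ _) _; rewrite leqNgt; apply/negP => Ez.
have := @trunc_logP 2 `|z| isT z0; rewrite leqNgt => /negP; apply.
by apply: leq_trans zE _; rewrite leq_pexp2l// ltnW.
Qed.

Lemma round_exp_bound z :
  (`|z| < 2 ^ round_exp z * 2 ^ s.+1)%N.
Proof.
rewrite -expnD /round_exp; apply: leq_trans (@trunc_log_ltn 2 `|z| isT) _.
by rewrite leq_pexp2l// addnS ltnS addnC -leq_subLR.
Qed.

Lemma float_roundE z u : (`|z| < 2 ^ E)%N ->
  let D := (2 ^ round_exp z)%N%:Z in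
  float_val (float_round z u) - z =
  (u < `|(z %% D)%Z|%N * 2 ^ (E - round_exp z))%N%:Z * D - (z %% D)%Z.
Proof.
move=> zE D; rewrite /float_val /float_round /= inordK ?ltnS ?round_exp_le//.
rewrite -/D; set b := (_ < _)%N; set p := (2 ^ (s + 2))%N%:Z.
have D0 : 0 < D by rewrite /D ltz_nat expn_gt0.
have zb : `|z| < D * (2 ^ s.+1)%N%:Z.
  by rewrite -abszE /D -PoszM ltz_nat round_exp_bound.
have pE : p = (2 ^ s.+1)%N%:Z * 2 by rewrite /p addn2 expnS mulnC PoszM.
have s2 : 2 <= (2 ^ s.+1)%N%:Z :> int.
  by rewrite lez_nat expnS leq_pmulr// expn_gt0.
have zDm := divz_eq z D; have r0 := modz_ge0 z (lt0r_neq0 D0).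
have rD := ltz_pmod z D0.
set q := (z %/ D)%Z in zDm *; set r := (z %% D)%Z in zDm r0 rD *.
(* The quotient is at most [2 ^ s.+1] in absolute value, so the mantissa shifted by [2 ^ (s + 2)] is
   in range and [inord] loses nothing. *)
have qlo : - (2 ^ s.+1)%N%:Z <= q.
  by rewrite -ltzD1 -(ltr_pM2r D0); move: zb; rewrite ltr_norml; lia.
have qhi : q < (2 ^ s.+1)%N%:Z.
  by rewrite -(ltr_pM2r D0); move: zb; rewrite ltr_norml; lia.
have b1 : b%:Z <= 1 by case: (b).
have b0 : 0 <= b%:Z by case: (b).
have k0 : 0 <= q + b%:Z + p by lia.
have kp : q + b%:Z + p < (2 ^ (s + 3)).+1%N%:Z.
  rewrite addn3 !expnS -expnS; lia.
rewrite inordK; last by rewrite -ltz_nat gez0_abs.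
rewrite gez0_abs// addrK mulrDr [X in _ - X]zDm; ring.
Qed.

(** Exactly [t] of the [2 ^ E] seeds round up, and [t * D = r * 2 ^ E]. *)
Lemma float_round_mean0 z : (`|z| < 2 ^ E)%N ->
  \sum_(u < 2 ^ E) (float_val (float_round z u) - z) = 0.
Proof.
move=> zE; under eq_bigr do rewrite float_roundE//.
have eE := round_exp_le zE; set D := (2 ^ _)%N%:Z; set r := (z %% D)%Z.
set t := (_ * _)%N.
have D0 : 0 < D by rewrite /D ltz_nat expn_gt0.
have r0 : 0 <= r by rewrite modz_ge0// lt0r_neq0.
have rD : r < D by rewrite ltz_pmod.
have tE : (t <= 2 ^ E)%N.
  have -> : (2 ^ E = 2 ^ (E - round_exp z) * 2 ^ round_exp z)%N.
    by rewrite -expnD subnK.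
  rewrite /t [leqLHS]mulnC leq_pmul2l ?expn_gt0//.
  by rewrite -lez_nat gez0_abs// ltW.
rewrite sumrB -mulr_suml sumr_const card_ord.
rewrite -(big_morph Posz PoszD erefl).
have -> : (\sum_(u < 2 ^ E) (u < t))%N = t.
  rewrite -big_mkcond/= sum1_card -[RHS](card_ord t).
  have inj : injective (widen_ord tE) by move=> x y /(congr1 val)/= /val_inj.
  rewrite -(card_imset _ inj); apply: eq_card => u.
  apply/idP/imsetP => [ut|[v _ ->]]; last by have := ltn_ord v; rewrite unfold_in.
  by exists (Ordinal ut) => //; exact: val_inj.
have -> : (2 ^ E = 2 ^ (E - round_exp z) * 2 ^ round_exp z)%N.
  by rewrite -expnD subnK.
by rewrite /t -[r in X in _ - X](gez0_abs r0) -mulr_natr natz !PoszM; ring.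
Qed.

(** Either the exponent is 0 and the rounding exact, or the error is at most the unit [D] and
    [D * 2 ^ s] is the largest power of two up to [|z|]. *)
Lemma float_round_err z u : (`|z| < 2 ^ E)%N ->
  `|float_val (float_round z u) - z| * (2 ^ s)%N%:Z <= `|z|.
Proof.
move=> zE; rewrite float_roundE//=.
set D := (2 ^ _)%N%:Z; set r := (z %% D)%Z; set b := (_ < _)%N.
have D0 : 0 < D by rewrite /D ltz_nat expn_gt0.
have r0 : 0 <= r by rewrite modz_ge0// lt0r_neq0.
have rD : r < D by rewrite ltz_pmod.
have [e0|e0] := posnP (round_exp z).
  have D1 : D = 1 by rewrite /D e0.
  have r_eq0 : r = 0 by lia.
  have -> : b = false by rewrite /b r_eq0 mul0n ltn0.
  have -> : false%:Z * D - r = 0 by lia.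
  by rewrite normr0 mul0r.
have le_D : `|b%:Z * D - r| <= D.
  by case: (b); rewrite ler_norml; lia.
apply: le_trans (ler_wpM2r _ le_D) _ => //.
rewrite /D -PoszM -expnD -abszE lez_nat.
have sT : (s <= trunc_log 2 `|z|)%N by move: e0; rewrite /round_exp; lia.
rewrite /round_exp subnK//; apply: trunc_logP => //.
rewrite lt0n; apply/eqP => z0; move: e0.
by rewrite /round_exp z0 trunc_log0 sub0n.
Qed.

End Rounding.

(** * Accumulation of rounding errors along a tree *)

Section TreeRounding.
Variables (R : realFieldType) (V : finType) (root : V) (par : V -> V).
Variables (dep : V -> nat) (d : nat).
Hypothesis dep_par : forall v, v != root -> dep v = (dep (par v)).+1.
Hypothesis dep_le : forall v, (dep v <= d)%N.
Variables (C : finType) (g : R) (rd : int -> C -> int).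
Variables (a T : V -> int) (Y : {ffun V -> C} -> V -> int).
Hypothesis C_gt0 : (0 < #|C|)%N.

Local Notation child := (child root par).

Let Z u v := a v + \sum_(c | child v c) Y u c.

Hypothesis TE : forall v, T v = a v + \sum_(c | child v c) T c.
Hypothesis YE : forall u v, Y u v = rd (Z u v) (u v).
Hypothesis rd_mean0 : forall u v, \sum_q (rd (Z u v) q - Z u v) = 0.
Hypothesis rd_err : forall u v q,
  `|rd (Z u v) q - Z u v|%:~R <= g * `|Z u v|%:~R :> R.

Let eta u v : R := (Y u v - Z u v)%:~R.
Let err u v : R := (Y u v - T v)%:~R.
Let cerr u v : R := \sum_(c | child v c) err u c.

(** [Y u w] reads only the seeds in the subtree of [w], where every vertex other than [w] is deeper
    than [w]. *)
Let Y_upd u v q w : w != v -> (dep v <= dep w)%N -> Y (upd u v q) w = Y u w.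
Proof.
move: w; apply: (tree_ind dep_par dep_le) => w IH wv vw.
rewrite !YE upd_neq//; congr (rd (_ + _) _).
have lt_c c : child w c -> (dep v < dep c)%N by move=> /(dep_child dep_par) ->.
apply: eq_bigr => c wc; apply: IH => //; last exact/ltnW/lt_c.
by apply: contraTneq (lt_c c wc) => ->; rewrite ltnn.
Qed.

Let Y_upd_child u v w q c : (dep v <= dep w)%N -> child w c ->
  Y (upd u v q) c = Y u c.
Proof.
move=> vw /(dep_child dep_par) dc; apply: Y_upd; last by rewrite dc ltnW.
by apply: contraTneq vw => <-; rewrite dc ltnn.
Qed.

Let cerr_upd u v w q : (dep v <= dep w)%N -> cerr (upd u v q) w = cerr u w.
Proof.
by move=> vw; apply: eq_bigr => c wc; rewrite /err (Y_upd_child _ _ vw wc).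
Qed.

Let Z_upd u v q : Z (upd u v q) v = Z u v.
Proof.
by congr (_ + _); apply: eq_bigr => c vc; rewrite (Y_upd_child _ _ _ vc).
Qed.

Let errE u v : err u v = eta u v + cerr u v.
Proof.
rewrite /err /eta /cerr; under eq_bigr do rewrite /err.
rewrite -(big_morph intr (@intrD R) (mulr0z _)) -intrD; congr (_%:~R).
by rewrite sumrB /Z {1}TE; ring.
Qed.

(* The rounding noise of a node has conditional mean zero given everything
   that does not depend on the randomness of this node. *)
Let eta_orth (f : {ffun V -> C} -> R) v :
  (forall u q, f (upd u v q) = f u) -> mean (fun u => eta u v * f u) = 0.
Proof.
move=> f_upd; rewrite -(mean_upd _ v)// -[RHS](mul0r #|{ffun V -> C}|%:R^-1).
congr (_ * _); apply: big1 => u _; rewrite -[RHS](mul0r #|C|%:R^-1).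
congr (_ * _); under eq_bigr do rewrite f_upd /eta YE Z_upd upd_same.
rewrite -mulr_suml -(big_morph intr (@intrD R) (mulr0z _)) rd_mean0.
by rewrite mulr0z mul0r.
Qed.

Let err_mean0 v : mean (fun u => err u v) = 0.
Proof.
move: v; apply: (tree_ind dep_par dep_le) => v IH.
rewrite (eq_mean (fun u => errE u v)) meanD mean_sum big1// addr0.
by rewrite -[RHS](@eta_orth (fun=> 1) v)//; apply: eq_mean => u; rewrite mulr1.
Qed.

Let cerr_mean0 v : mean (fun u => cerr u v) = 0.
Proof. by rewrite mean_sum big1. Qed.

(** Disjoint subtrees use disjoint seeds. The fresh noises drop out by [eta_orth]; the product of
    the inherited errors is a sum over pairs of distinct children of equal depth. *)
Let err_orth v w : v != w -> dep v = dep w ->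
  mean (fun u => err u v * err u w) = 0.
Proof.
have [k] := ubnP (d - dep v); elim: k v w => // k IH v w; rewrite ltnS => le_k.
move=> vw dvw.
have wv : w != v by rewrite eq_sym.
have dE u : err u v * err u w =
    eta u v * err u w + (eta u w * cerr u v + cerr u v * cerr u w).
  rewrite {1}errE mulrDl; congr (_ + _).
  by rewrite errE mulrDr mulrC.
rewrite (eq_mean dE) !meanD eta_orth ?add0r; last first.
  by move=> u q; rewrite /err Y_upd// dvw.
rewrite eta_orth ?add0r; last by move=> u q; rewrite cerr_upd// dvw.
under eq_mean do rewrite /cerr mulr_suml.
rewrite mean_sum big1// => c vc; under eq_mean do rewrite mulr_sumr.
rewrite mean_sum big1// => c' wc'.
have dc := dep_child dep_par vc; have dc' := dep_child dep_par wc'.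
apply: IH; last by rewrite dc dc' dvw.
  by rewrite (leq_trans _ le_k)// dc ltn_sub2l// -dc.
apply: contraNneq vw => cc'; move: vc wc'; rewrite cc'.
by move=> /andP[_ /eqP <-] /andP[_ /eqP <-].
Qed.

Let cerr_sqr v :
  mean (fun u => cerr u v ^+ 2) = \sum_(c | child v c) mean (fun u => err u c ^+ 2).
Proof.
under eq_mean do rewrite expr2 /cerr mulr_suml.
rewrite mean_sum; apply: eq_bigr => c vc.
under eq_mean do rewrite mulr_sumr (bigD1 c)//=.
rewrite meanD mean_sum big1 ?addr0//.
move=> c' /andP[vc' cc']; apply: err_orth; first by rewrite eq_sym.
by rewrite (dep_child dep_par vc) (dep_child dep_par vc').
Qed.

(** Fresh noise is orthogonal to the inherited error, and so are the errors of distinct children to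
    each other. The noise is relative to [Z], whose second moment is [T ^ 2] plus the mean squared
    errors of the children. *)
Lemma tree_rounding v :
  let mu v := mean (fun u => (Y u v - T v)%:~R ^+ 2) in
  mu v <= g ^+ 2 * ((T v)%:~R ^+ 2 + \sum_(c | child v c) mu c)
          + \sum_(c | child v c) mu c.
Proof.
pose mu v := mean (fun u => (Y u v - T v)%:~R ^+ 2) : R; rewrite -/mu /=.
have dE u : err u v ^+ 2 =
    eta u v ^+ 2 + (2 * (eta u v * cerr u v) + cerr u v ^+ 2).
  by rewrite errE; ring.
rewrite {1}/mu (eq_mean dE) !meanD meanZ eta_orth ?mulr0 ?add0r; last first.
  by move=> u q; rewrite cerr_upd.
rewrite cerr_sqr lerD2r.
have ZE u : (Z u v)%:~R = (T v)%:~R + cerr u v.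
  rewrite /cerr /err -(big_morph intr (@intrD R) (mulr0z _)) -intrD.
  by congr (_%:~R); rewrite sumrB /Z {1}TE; ring.
have le_eta u : eta u v ^+ 2 <= g ^+ 2 * (Z u v)%:~R ^+ 2.
  rewrite -exprMn -(real_normK (num_real (eta u v))).
  rewrite -(real_normK (num_real (g * _))).
  rewrite lerXn2r ?nnegrE// /eta YE -intr_norm.
  apply: le_trans (rd_err _ _ _) _; rewrite normrM intr_norm ler_wpM2r//.
  exact: ler_norm.
apply: le_trans (mean_le le_eta) _; rewrite meanZ ler_wpM2l ?sqr_ge0//.
have Z2 u : (Z u v)%:~R ^+ 2 =
    (T v)%:~R ^+ 2 + (2 * (T v)%:~R * cerr u v + cerr u v ^+ 2).
  by rewrite ZE; ring.
rewrite (eq_mean Z2) !meanD mean_cst ?card_ffun ?expn_gt0 ?C_gt0//.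
by rewrite meanZ cerr_mean0 mulr0 add0r cerr_sqr.
Qed.

End TreeRounding.

Section SubtreeBounds.
Variables (V : finType) (root : V) (par : V -> V) (dep : V -> nat) (d : nat).
Hypothesis dep_par : forall v, v != root -> dep v = (dep (par v)).+1.
Hypothesis dep_le : forall v, (dep v <= d)%N.

Local Notation child := (child root par).

Lemma subtree_sum_le (l ls : V -> nat) v :
  (forall v, ls v = l v + \sum_(c | child v c) ls c)%N -> (ls v <= ls root)%N.
Proof.
move=> lsE; have [k] := ubnP (dep v); elim: k v => // k IH v; rewrite ltnS => vk.
have [->//|vr] := eqVneq v root.
apply: leq_trans (IH (par v) _); last by rewrite -(dep_par vr).
by rewrite [leqRHS]lsE (bigD1 v) ?child_par//= addnCA leq_addr.
Qed.

(** Each rounding at most doubles its argument, so a value is bounded by the mass [ls] of its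
    subtree times one factor 2 per level below. This keeps all roundings in the range where their
    guarantees hold. *)
Lemma sketch_bound (C : Type) (rd : int -> C -> int) (Zmax : nat)
    (a Y : V -> int) (u : V -> C) (l ls : V -> nat) v :
  (forall z q, (`|z| <= Zmax)%N -> (`|rd z q| <= 2 * `|z|)%N) ->
  (forall v, `|a v| <= l v)%N ->
  (forall v, ls v = l v + \sum_(c | child v c) ls c)%N ->
  (2 ^ d * ls root <= Zmax)%N ->
  (forall v, Y v = rd (a v + \sum_(c | child v c) Y c) (u v)) ->
  (`|(a v + \sum_(c | child v c) Y c)%R| <= Zmax)%N.
Proof.
move=> rd2 al lsE lsZ YE.
have ls_le w : (2 ^ (d - dep w) * ls w <= Zmax)%N.
  apply: leq_trans lsZ; apply: leq_mul (subtree_sum_le _ lsE).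
  by rewrite leq_pexp2l// leq_subr.
suff H w : (`|(a w + \sum_(c | child w c) Y c)%R| <= 2 ^ (d - dep w) * ls w)%N.
  exact: leq_trans (H v) (ls_le v).
move: w; apply: (tree_ind dep_par dep_le) => w IH.
rewrite -lez_nat abszE; apply: le_trans (ler_normD _ _) _.
rewrite lsE mulnDr PoszD lerD//.
  rewrite -abszE lez_nat (leq_trans (al w))// leq_pmull// expn_gt0//.
apply: le_trans (ler_norm_sum _ _ _) _.
rewrite big_distrr/= (big_morph Posz PoszD erefl); apply: ler_sum => c wc.
rewrite -abszE lez_nat YE; apply: leq_trans (rd2 _ _ _) _.
  exact: leq_trans (IH _ wc) (ls_le c).
apply: leq_trans (leq_mul (leqnn 2) (IH _ wc)) _.
rewrite mulnA -expnS leq_mul2r leq_pexp2l ?orbT//.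
by have := dep_child dep_par wc; have := dep_le c; lia.
Qed.

End SubtreeBounds.

(** * Count-sketch *)

Definition sgb (b : bool) : int := (-1) ^+ b.

Lemma sgb_sqr b : sgb b * sgb b = 1.
Proof. by case: b. Qed.

(** Resampling the sign of [i] cancels its products with all other signs. *)
Lemma sign_moment (R : realFieldType) (I : finType) (J : pred I) (y : I -> R) :
  mean (fun s : {ffun I -> bool} => (\sum_(j | J j) (sgb (s j))%:~R * y j) ^+ 2)
  = \sum_(j | J j) y j ^+ 2.
Proof.
under eq_mean do rewrite expr2 mulr_suml.
rewrite mean_sum; apply: eq_bigr => i Ji.
under eq_mean do rewrite mulr_sumr (bigD1 i)//=.
rewrite meanD mean_sum big1 ?addr0; last first.
  move=> j /andP[Jj ji]; rewrite -(mean_upd _ i) ?card_bool//.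
  rewrite /mean big1 ?mul0r// => s _; rewrite big_bool !upd_same !upd_neq//=.
  by rewrite /sgb; set t := (_ * y j); rewrite expr1 expr0 rmorphN1; ring.
rewrite (@eq_mean _ _ _ (fun=> y i ^+ 2)).
  by rewrite mean_cst// card_ffun card_bool expn_gt0.
by move=> s; rewrite mulrACA -intrM sgb_sqr mul1r.
Qed.

Lemma collision_mean (R : realFieldType) (I B : finType) (i j : I) :
  (0 < #|B|)%N -> j != i ->
  mean (fun h : {ffun I -> B} => (h j == h i)%:R) = #|B|%:R^-1 :> R.
Proof.
move=> B0 ji; rewrite -(mean_upd _ j)//.
rewrite (@eq_mean _ _ _ (fun=> #|B|%:R^-1)).
  by rewrite mean_cst// card_ffun expn_gt0 B0.
move=> h; under eq_mean do rewrite upd_same upd_neq 1?[i == j]eq_sym//.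
by have /= -> := mean_indicator R (pred1 (h i)); rewrite card1 mul1r.
Qed.

Section RowEstimate.
Variables (R : realFieldType) (V : finType) (root : V) (par : V -> V).
Variables (dep : V -> nat) (d : nat).
Hypothesis dep_par : forall v, v != root -> dep v = (dep (par v)).+1.
Hypothesis dep_le : forall v, (dep v <= d)%N.
Hypothesis dep_root : dep root = 0%N.
Variables (C : finType) (g : R) (rd : int -> C -> int) (Zmax : nat).
Hypothesis C_gt0 : (0 < #|C|)%N.
Hypothesis rd_le2 : forall z q, (`|z| <= Zmax)%N -> (`|rd z q| <= 2 * `|z|)%N.
Hypothesis rd_mean0 : forall z, (`|z| <= Zmax)%N -> \sum_q (rd z q - z) = 0.
Hypothesis rd_err : forall z q, (`|z| <= Zmax)%N ->
  `|rd z q - z|%:~R <= g * `|z|%:~R :> R.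
Variables (I : finType) (X xs : V -> I -> nat).

Local Notation child := (child root par).

Hypothesis xsE : forall v j, (xs v j = X v j + \sum_(c | child v c) xs c j)%N.
Hypothesis xs_le : (2 ^ d * \sum_j xs root j <= Zmax)%N.

Let x j : R := (xs root j)%:R.
Let rate : R := (1 + g ^+ 2) ^+ d.+1 - 1.

Definition bucket_sketch (s : {ffun I -> bool}) (J : pred I)
    (X : V -> I -> nat) v : int :=
  \sum_(j | J j) sgb (s j) * (X v j)%:Z.

Let sketch_xsE s J v : bucket_sketch s J xs v =
  bucket_sketch s J X v + \sum_(c | child v c) bucket_sketch s J xs c.
Proof.
rewrite /bucket_sketch exchange_big -big_split/=; apply: eq_bigr => j _.
by rewrite xsE PoszD (big_morph Posz PoszD erefl) mulrDr mulr_sumr.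
Qed.

Let sketch_sqr J v :
  mean (fun s => (bucket_sketch s J xs v)%:~R ^+ 2) =
  \sum_(j | J j) (xs v j)%:R ^+ 2 :> R.
Proof.
rewrite -sign_moment; apply: eq_mean => s; congr (_ ^+ 2).
rewrite (big_morph intr (@intrD R) (mulr0z _)); apply: eq_bigr => j _.
by rewrite intrM.
Qed.

(** Nonnegativity of the inputs enters here: a sum of squares is at most the square of the sum. *)
Let xs_sqr_le J v :
  \sum_(c | child v c) \sum_(j | J j) (xs c j)%:R ^+ 2 <=
  \sum_(j | J j) (xs v j)%:R ^+ 2 :> R.
Proof.
rewrite exchange_big/=; apply: ler_sum => j _.
apply: (@le_trans _ _ ((\sum_(c | child v c) (xs c j)%:R) ^+ 2)).
  rewrite [leRHS]expr2 mulr_suml; apply: ler_sum => c vc.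
  rewrite expr2 ler_wpM2l// (bigD1 c)//= lerDl sumr_ge0//.
by rewrite lerXn2r ?nnegrE ?sumr_ge0// -natr_sum ler_nat xsE leq_addl.
Qed.

(* The bound (1 + g^2)^j - 1 for a subtree of height j solves the recursion
   provided by [tree_rounding]. *)
Lemma bucket_rounding (J : pred I)
    (Y : {ffun I -> bool} -> {ffun V -> C} -> V -> int) :
  (forall s u v, Y s u v =
     rd (bucket_sketch s J X v + \sum_(c | child v c) Y s u c) (u v)) ->
  mean (fun s => mean (fun u => (Y s u root - bucket_sketch s J xs root)%:~R ^+ 2))
  <= rate * \sum_(j | J j) x j ^+ 2.
Proof.
move=> YE; have Zle s u v :
    (`|(bucket_sketch s J X v + \sum_(c | child v c) Y s u c)%R| <= Zmax)%N.
  apply: (@sketch_bound _ _ _ _ _ dep_par dep_le _ rd Zmax _ _ u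
    (fun v => \sum_j X v j)%N (fun v => \sum_j xs v j)%N) => //.
    move=> w; rewrite -lez_nat abszE; apply: le_trans (ler_norm_sum _ _ _) _.
    rewrite (big_morph Posz PoszD erefl) big_mkcond; apply: ler_sum => j _.
    by case: ifP => // _; case: (s j);
      rewrite /sgb ?expr1 ?expr0 ?mulN1r ?mul1r ?normrN.
  move=> w; rewrite exchange_big -big_split; apply: eq_bigr => j _; exact: xsE.
pose mu s v := mean (fun u => (Y s u v - bucket_sketch s J xs v)%:~R ^+ 2) : R.
pose N v : R := \sum_(j | J j) (xs v j)%:R ^+ 2.
suff H v : mean (fun s => mu s v) <= ((1 + g ^+ 2) ^+ (d - dep v).+1 - 1) * N v.
  by have := H root; rewrite dep_root subn0.
have b1 : 1 <= 1 + g ^+ 2 by rewrite lerDl sqr_ge0.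
move: v; apply: (tree_ind dep_par dep_le) => v IH.
have step s : mu s v <= g ^+ 2 * ((bucket_sketch s J xs v)%:~R ^+ 2 +
    \sum_(c | child v c) mu s c) + \sum_(c | child v c) mu s c.
  apply: (@tree_rounding R V root par dep d dep_par dep_le C g rd
    (bucket_sketch s J X) (bucket_sketch s J xs) (Y s)) => //.
  - by move=> u w; exact: rd_mean0.
  - by move=> u w q; exact: rd_err.
apply: le_trans (mean_le step) _.
rewrite meanD meanZ meanD sketch_sqr mean_sum -/(N v).
have N0 w : 0 <= N w by apply: sumr_ge0 => j _; exact: sqr_ge0.
set b := 1 + g ^+ 2 in b1 IH *; have -> : g ^+ 2 = b - 1 by rewrite /b; ring.
set k := (d - dep v)%N.
have le_c : \sum_(c | child v c) mean (mu^~ c) <= (b ^+ k - 1) * N v.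
  apply: (@le_trans _ _ (\sum_(c | child v c) (b ^+ k - 1) * N c)).
    apply: ler_sum => c vc; apply: le_trans (IH c vc) _.
    rewrite ler_wpM2r// lerD2r ler_weXn2l// /k.
    by have := dep_child dep_par vc; have := dep_le c; lia.
  by rewrite -mulr_sumr ler_wpM2l ?xs_sqr_le// subr_ge0 exprn_ege1.
set S := \sum_(c | _) _ in le_c *.
(* From [S <= (b ^ k - 1) * N] follows [(b - 1) * (N + S) + S <= (b ^ k.+1 - 1) * N]. *)
rewrite exprS.
have b0 : 0 <= b - 1 by rewrite subr_ge0.
have := ler_wpM2l b0 le_c; nra.
Qed.

Section Estimate.
Variables (B : finType) (heavy : pred I) (i : I).
Variable Y : {ffun I -> B} -> {ffun I -> bool} -> {ffun V -> C} -> B -> V -> int.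
Hypothesis B_gt0 : (0 < #|B|)%N.
Hypothesis YE : forall h s u b v, Y h s u b v =
  rd (bucket_sketch s [pred j | h j == b] X v
      + \sum_(c | child v c) Y h s u b c) (u v).

Let seed : finType := ({ffun I -> B} * {ffun I -> bool} * {ffun V -> C})%type.

Definition row_estimate (w : seed) : int :=
  sgb (w.1.2 i) * Y w.1.1 w.1.2 w.2 (w.1.1 i) root.

Let sqerr w : R := ((row_estimate w)%:~R - x i) ^+ 2.
Let isolated (h : {ffun I -> B}) :=
  [forall j, heavy j && (j != i) ==> (h j != h i)].
Let light : R := \sum_(j | ~~ heavy j) x j ^+ 2.
Let bound : R := 2 * (light / #|B|%:R) + 2 * rate * (x i ^+ 2 + light / #|B|%:R).

Let rate_ge0 : 0 <= rate.
Proof. by rewrite subr_ge0 exprn_ege1// lerDl sqr_ge0. Qed.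

Let light_bucket (h : {ffun I -> B}) : R :=
  \sum_(j | ~~ heavy j && (j != i)) (h j == h i)%:R * x j ^+ 2.

Let light_bucket_mean : mean light_bucket <= light / #|B|%:R.
Proof.
rewrite /light_bucket mean_sum /light mulr_suml.
rewrite big_mkcond [leRHS]big_mkcond/=; apply: ler_sum => j _.
case: ifP => [/andP[-> ji]|_].
  under eq_mean do rewrite mulrC.
  by rewrite meanZ collision_mean.
by case: ifP => // _; rewrite mulr_ge0 ?sqr_ge0 ?invr_ge0.
Qed.

(** The coordinates that share the bucket with [i] are all light, so the error is a light collision
    noise [A] plus a rounding noise [D], and [(A + D) ^ 2 <= 2 * A ^ 2 + 2 * D ^ 2]. *)
Let isolated_error h : isolated h ->
  mean (fun s => mean (fun u => sqerr (h, s, u))) <=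
  2 * light_bucket h + 2 * rate * (x i ^+ 2 + light_bucket h).
Proof.
move=> /forallP iso; pose J := [pred j | h j == h i].
have bucketE (f : I -> R) : \sum_(j | J j && (j != i)) f j =
    \sum_(j | ~~ heavy j && (j != i)) (h j == h i)%:R * f j.
  rewrite big_mkcond [RHS]big_mkcond/=; apply: eq_bigr => j _.
  case: eqVneq (iso j) => [->|ji]; rewrite ?andbF//= !andbT.
  by case: (heavy j) => /=; case: eqP => //=; rewrite ?mul0r ?mul1r.
have le_err s u : sqerr (h, s, u) <=
    2 * (\sum_(j | J j && (j != i)) (sgb (s j))%:~R * x j) ^+ 2 +
    2 * (Y h s u (h i) root - bucket_sketch s J xs root)%:~R ^+ 2.
  set A := \sum_(j | _) _; set D : R := (_ - _)%:~R.
  have -> : sqerr (h, s, u) = (A + D) ^+ 2.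
    have TE : (bucket_sketch s J xs root)%:~R = (sgb (s i))%:~R * x i + A.
      rewrite (big_morph intr (@intrD R) (mulr0z _)) (bigD1 i) ?inE//= intrM.
      by congr (_ + _); apply: eq_bigr => j _; rewrite intrM.
    rewrite /sqerr /row_estimate /= intrM /D rmorphB /= TE.
    by case: (s i); rewrite /sgb ?expr0 ?expr1 ?rmorphN1 ?rmorph1; ring.
  have := sqr_ge0 (A - D); lra.
apply: le_trans (mean_le (fun s => mean_le (le_err s))) _.
rewrite (@eq_mean _ _ _ (fun s : {ffun I -> bool} =>
    2 * (\sum_(j | J j && (j != i)) (sgb (s j))%:~R * x j) ^+ 2 +
    2 * mean (fun u => (Y h s u (h i) root - bucket_sketch s J xs root)%:~R ^+ 2)));
  last by move=> s; rewrite meanD mean_cst ?card_ffun ?expn_gt0 ?C_gt0// meanZ.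
rewrite meanD !meanZ sign_moment bucketE lerD// -mulrA ler_wpM2l//.
have := @bucket_rounding J (fun s u => Y h s u (h i))
  (fun s u v => YE h s u (h i) v).
by rewrite (bigD1 i) ?inE//= bucketE.
Qed.

(** The rate 1/15 is what [majority_fails] tolerates. A union bound on collisions of [i] with heavy
    coordinates takes 1/20 of it, Markov's inequality on isolated hashings 1/60. *)
Lemma row_failure theta : (20 * #|heavy| <= #|B|)%N -> 60 * bound <= theta ->
  mean (fun w => (theta < sqerr w)%R%:R) <= 15^-1 :> R.
Proof.
move=> heavyB le_theta.
pose f (w : seed) : R := (isolated w.1.1)%:R * sqerr w.
have light0 : 0 <= light by apply: sumr_ge0 => j _; exact: sqr_ge0.
have lB0 : 0 <= light / #|B|%:R by rewrite divr_ge0.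
have bound0 : 0 <= bound.
  by have := rate_ge0; have := sqr_ge0 (x i); rewrite /bound; nra.
have mean_f : mean f <= bound.
  rewrite mean_pair mean_pair/=.
  apply: (@le_trans _ _ (mean (fun h =>
      2 * light_bucket h + 2 * rate * (x i ^+ 2 + light_bucket h)))).
    apply: mean_le => h; rewrite /f/=.
    have lb0 : 0 <= light_bucket h.
      by apply: sumr_ge0 => j _; rewrite mulr_ge0 ?sqr_ge0.
    case: (boolP (isolated h)) => [/isolated_error|_].
      by under [X in _ -> X <= _]eq_mean do under eq_mean do rewrite mul1r.
    rewrite (@eq_mean _ _ _ (fun=> 0)); last first.
      by move=> s; rewrite /mean big1 ?mul0r// => u _; rewrite mul0r.
    rewrite /mean big1// mul0r.
    by have := rate_ge0; have := sqr_ge0 (x i); nra.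
  rewrite meanD !meanZ meanD mean_cst ?card_ffun ?expn_gt0 ?B_gt0//.
  have := light_bucket_mean; have := rate_ge0; rewrite /bound; nra.
have ind w : (theta < sqerr w)%R%:R <=
    \sum_(j | heavy j && (j != i)) (w.1.1 j == w.1.1 i)%:R +
    (theta < f w)%R%:R :> R.
  have S0 : 0 <= \sum_(j | heavy j && (j != i)) (w.1.1 j == w.1.1 i)%:R :> R.
    exact: sumr_ge0.
  rewrite /f; case: (boolP (isolated w.1.1)) => [_|].
    by rewrite mul1r lerDr.
  rewrite negb_forall => /existsP[j]; rewrite negb_imply negbK => /andP[hj eq_h].
  rewrite (bigD1 j)//= eq_h -!addrA; case: (_ < _) => //=; last first.
    by rewrite addr_ge0// addr_ge0// sumr_ge0.
  by rewrite lerDl addr_ge0// sumr_ge0.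
apply: le_trans (mean_le ind) _; rewrite meanD.
have -> : 15^-1 = 20^-1 + 60^-1 :> R by field.
apply: lerD; last first.
  apply: markov_mean.
  - by move=> w; rewrite mulr_ge0// sqr_ge0.
  - by apply: le_trans le_theta; rewrite mulr_ge0.
  - by apply: le_trans mean_f _; rewrite ler_pdivlMl.
  - by rewrite invr_ge0.
rewrite mean_sum.
apply: (@le_trans _ _ (\sum_(j | heavy j) #|B|%:R^-1)).
  rewrite big_mkcond [leRHS]big_mkcond/=; apply: ler_sum => j _.
  case: ifP => [/andP[-> ji]|_]; last by case: ifP => // _; rewrite invr_ge0.
  rewrite mean_pair mean_pair/= -(collision_mean R B_gt0 ji).
  apply: mean_le => h; rewrite (@eq_mean _ _ _ (fun=> (h j == h i)%:R)).
    by rewrite mean_cst// card_ffun card_bool expn_gt0.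
  by move=> s; rewrite mean_cst// card_ffun expn_gt0 C_gt0.
have -> : \sum_(j | heavy j) #|B|%:R^-1 = #|heavy|%:R / #|B|%:R :> R.
  by rewrite sumr_const mulrC mulr_natr.
rewrite ler_pdivrMr ?ltr0n// ler_pdivlMl//.
by rewrite -natrM ler_nat.
Qed.

End Estimate.

End RowEstimate.

(** * Medians and largest coordinates *)

Definition median (s : seq int) : int := nth 0 (sort <=%R s) (size s)./2.

(** If the median violates [P], then by convexity so does everything on one side of it in the sorted
    list; together with the median this is at least half of the list. *)
Lemma median_majority (P : pred int) (s : seq int) :
  (forall a b c, a <= b -> b <= c -> P a -> P c -> P b) ->
  (2 * count (predC P) s < size s)%N -> P (median s).
Proof.
move=> convP; rewrite /median; set t := sort _ _.
have pt : perm_eq t s by rewrite perm_sort.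
have st : size t = size s by apply: perm_size.
rewrite -(permP pt) -st; set m := (size t)./2 => lt_c.
have t_sorted : sorted <=%R t by apply: sort_sorted; exact: le_total.
have mt : (m < size t)%N by rewrite /m; lia.
apply: contraLR lt_c => nP; rewrite -leqNgt.
have le_nth i j : (i <= j)%N -> (j < size t)%N -> nth 0 t i <= nth 0 t j.
  move=> ij jt; apply: (sorted_leq_nth le_trans lexx) => //.
  by rewrite inE (leq_ltn_trans ij).
have [hl|/hasPn hl] := boolP (has P (take m t)).
  have cr : all (predC P) (drop m t).
    apply/(all_nthP 0) => j; rewrite size_drop nth_drop => jt /=.
    apply: contraNN nP => Pj; have /hasP[y /(nthP 0)[i]] := hl.
    rewrite size_takel ?(ltnW mt)// => im <- Pi; rewrite nth_take// in Pi.
    apply: convP Pi Pj; apply: le_nth; rewrite ?(ltnW im) ?leq_addr//.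
    by rewrite -ltn_subRL.
  have := cr; rewrite all_count size_drop => /eqP dE.
  rewrite -{2}(cat_take_drop m t) count_cat dE; move: (count _ _) mt => c.
  by rewrite /m; move: (size t) => N; lia.
have cl : all (predC P) (take m.+1 t).
  rewrite (take_nth 0)// all_rcons /= nP/=; exact/allP.
have := cl; rewrite all_count size_takel// => /eqP dE.
rewrite -{2}(cat_take_drop m.+1 t) count_cat dE; move: (count _ _) mt => c.
by rewrite /m; move: (size t) => N; lia.
Qed.

Section Largest.
Variables (n k : nat).

(** The same selection as in [tail], also applied to the integer estimates. *)
Definition largest (D : realDomainType) (f : 'I_n -> D) : seq 'I_n :=
  take k (sort (fun i j => f j <= f i) (enum 'I_n)).

Lemma largest_uniq (D : realDomainType) (f : 'I_n -> D) : uniq (largest f).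
Proof. by rewrite take_uniq// sort_uniq enum_uniq. Qed.

Lemma size_largest (D : realDomainType) (f : 'I_n -> D) :
  size (largest f) = minn k n.
Proof. by rewrite size_take_min size_sort size_enum_ord. Qed.

Lemma largest_ge (D : realDomainType) (f : 'I_n -> D) i j :
  i \notin largest f -> j \in largest f -> f i <= f j.
Proof.
rewrite /largest; set s := sort _ _ => ik jk.
have s_sorted : sorted (fun i j => f j <= f i) s.
  by apply: sort_sorted => a b; exact: le_total.
have all_s a : a \in s by rewrite mem_sort mem_enum.
have lt_j : (index j s < k)%N by rewrite -in_take.
have ge_i : (k <= index i s)%N by rewrite leqNgt -in_take.
have tr : transitive (fun i j => f j <= f i).
  by move=> a b c ba cb; exact: le_trans cb ba.
apply: (sorted_leq_index tr (fun a => lexx (f a)) s_sorted) => //.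
exact/ltnW/(leq_trans lt_j).
Qed.

(** Both lists are duplicate-free of length [minn k n], so an inclusion would make them equal as
    sets. *)
Lemma largest_exchange (D D' : realDomainType) (f : 'I_n -> D) (g : 'I_n -> D') i :
  i \in largest f -> i \notin largest g ->
  exists2 j, j \in largest g & j \notin largest f.
Proof.
move=> fi gi; apply/allPn; apply: contra gi => /allP gf.
by rewrite (uniq_min_size _ gf _).2 ?largest_uniq// !size_largest.
Qed.

End Largest.

Lemma heavy_recovery (R : realFieldType) n k (x : 'I_n -> R) (est : 'I_n -> int)
    (t eps : R) :
  0 <= t -> 0 < eps < 1 -> (forall i, 0 <= x i) ->
  (forall i, i \notin largest k x -> x i <= t) ->
  (forall i, `|(est i)%:~R - x i| <= eps / 4 * t + eps / 8 * x i) ->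
  forall i, i \notin largest k est -> `|(est i)%:~R - x i| <= eps * t.
Proof.
move=> t0 /andP[eps0 eps1] x0 xt estE i ni.
suff xi : x i <= 2 * t by apply: le_trans (estE i) _; nra.
have [hi|hi] := boolP (i \in largest k x); last by have := xt i hi; lra.
have [j jl jx] := largest_exchange hi ni.
(* [est i <= est j] and [x j <= t] give [(1 - eps / 8) * x i <= (1 + 5 * eps / 8) * t], and for
   [eps < 1] the ratio is below 13/7. *)
have := largest_ge ni jl; rewrite -(ler_int R) => le_est.
have := xt _ jx; have := estE i; have := estE j; rewrite !ler_norml.
have := x0 i; have := x0 j.
move: (x i) (x j) (est i)%:~R (est j)%:~R le_est => a b A B AB a0 b0.
move=> /andP[h1 h2] /andP[h3 h4] bt; nra.
Qed.

(** * Counting bits *)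

Section BitCount.
Variable R : realType.

Lemma ln2_ge : 2^-1 <= ln 2 :> R.
Proof.
have := @le_ln1Dx R (- 2^-1); have -> : 1 - 2^-1 = 2^-1 :> R by field.
by rewrite lnV ?posrE// lerN2; apply; lra.
Qed.

Lemma ln2_le1 : ln 2 <= 1 :> R.
Proof. by have := @le_ln1Dx R 1; apply; lra. Qed.

(** Needed for [ln (ln 3) > 0]. The witness is [(6 / 5) ^ 6 < 3] together with
    [ln (6 / 5) >= 1 / 6]. *)
Lemma ln3_gt1 : 1 < ln 3 :> R.
Proof.
have h : 6^-1 <= ln (6 / 5) :> R.
  have := @le_ln1Dx R (- 6^-1).
  have -> : 1 - 6^-1 = (6 / 5)^-1 :> R by field.
  by rewrite lnV ?posrE ?divr_gt0// lerN2; apply; lra.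
have : ln ((6 / 5) ^+ 6) < ln 3 :> R.
  rewrite ltr_ln ?posrE ?exprn_gt0 ?divr_gt0//.
  by rewrite expr_div_n ltr_pdivrMr ?exprn_gt0// -!natrX -natrM ltr_nat.
by rewrite lnXn ?divr_gt0// -[_ *+ 6]mulr_natl; lra.
Qed.

Lemma up_log_ln x : (0 < x)%N -> (up_log 2 x)%:R <= 1 + 2 * ln x%:R :> R.
Proof.
case: x => [//|[|x]] _; first by rewrite up_log1 ln1 mulr0 addr0.
have := @up_log_gtn 2 x.+2 isT isT; have := up_log_gt0 2 x.+2 => /=.
case: (up_log _ _) => [//|p] _ /= px.
have : ln (2 ^+ p) <= ln x.+2%:R :> R.
  by rewrite ler_ln ?posrE ?exprn_gt0// -natrX ler_nat ltnW.
rewrite lnXn// -[_ *+ p]mulr_natl => lp; rewrite -[p.+1]addn1 natrD.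
have p0 : 0 <= p%:R :> R by [].
have := ler_wpM2l p0 ln2_ge; lra.
Qed.

Lemma ln_dS (d : nat) : ln d.+1%:R <= ln d%:R + 1 :> R.
Proof.
case: d => [|d]; first by rewrite ln1 ln0// add0r.
apply: (@le_trans _ _ (ln (d.+1%:R * 2))).
  by rewrite ler_ln ?posrE ?mulr_gt0// -natrM ler_nat; lia.
by rewrite lnM ?posrE// lerD2l ln2_le1.
Qed.

(** The three summands are the lengths of the sketch table, of the broadcast list of indices and of
    the list of exact sums. *)
Lemma bit_count (c' K : R) (c2 j1 j2 : nat) : exists2 C : R, 0 < C &
  forall (n d m M k s : nat) (eps : R),
    (3 <= n)%N -> (0 < m)%N -> 0 < eps < 1 ->
    m%:R <= K * n%:R `^ c' -> M%:R <= K * n%:R `^ c' ->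
    (0 < k)%N -> k%:R <= 2 * eps ^- 2 ->
    s = up_log 2 (2 ^ j2 * (d.+1 * k)) ->
    (c2 * up_log 2 n * 2 ^ up_log 2 (2 ^ j1 * k)
       * (up_log 2 (d + up_log 2 (n * (m * M)).+1).+1 + (s + 4))
     + k * up_log 2 n + k * up_log 2 (m * M).+2)%:R
    <= C * edge_bound n d eps.
Proof.
pose K1 := Num.max K 1; pose c1 := Num.max c' 0.
have K11 : 1 <= K1 by rewrite le_max lexx orbT.
have KK1 : K <= K1 by rewrite le_max lexx.
have c10 : 0 <= c1 by rewrite le_max lexx orbT.
have cc1 : c' <= c1 by rewrite le_max lexx.
pose A := 7 + 4 * ln K1 + 4 * c1; pose A2 := 12 + 2 * j2%:R + 2 * ln (A + 1).
(* For [n >= 3] the last factor of [edge_bound] is at least [t0 > 0] and so absorbs additive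
   constants. *)
pose t0 : R := ln (ln 3).
have t00 : 0 < t0 by rewrite ln_gt0// ln3_gt1.
have lnK1 : 0 <= ln K1 by rewrite ln_ge0.
have A0 : 0 <= A by rewrite /A; lra.
have lnA : 0 <= ln (A + 1) by rewrite ln_ge0//; lra.
have j20 : 0 <= j2%:R :> R by [].
have A20 : 0 <= A2 by rewrite /A2; lra.
exists (12 * (2 ^ j1)%:R * c2%:R * (A2 / t0 + 4) + 2 * (3 + A) / t0).
  apply: ltr_wpDl; first by rewrite !mulr_ge0 ?addr_ge0 ?divr_ge0// ltW.
  by rewrite divr_gt0 ?mulr_gt0//; lra.
move=> n d m M k s eps n3 m0 /andP[eps0 eps1] mK MK k0 kle sE.
rewrite /edge_bound; set L := ln n%:R; set D := ln d%:R; set e := ln eps^-1.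
have n0 : 0 < n%:R :> R by rewrite ltr0n (leq_trans _ n3).
have n1 : 1 <= n%:R :> R by rewrite ler1n (leq_trans _ n3).
have L3 : ln 3 <= L by rewrite ler_ln ?posrE// ler_nat.
have L1 : 1 <= L by apply: ltW; apply: lt_le_trans L3; exact: ln3_gt1.
have ll : t0 <= ln L by rewrite ler_ln ?posrE//; have := ln3_gt1; lra.
have D0 : 0 <= D.
  rewrite /D; have [->|dp] := posnP d; first by rewrite ln0.
  by rewrite ln_ge0// ler1n.
have e0 : 0 <= e by rewrite ln_ge0// invf_ge1// ltW.
set th := ln L + D + e; have th0 : t0 <= th by rewrite /th; lra.
set q : R := eps ^- 2 in kle *.
have q0 : 0 < q by rewrite invr_gt0 exprn_gt0.
have lnq : ln q = 2 * e.
  by rewrite /q -exprVn lnXn ?invr_gt0// -[_ *+ 2]mulr_natl.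
have kR0 : 0 < k%:R :> R by rewrite ltr0n.
have lnk : ln k%:R <= 1 + 2 * e.
  apply: (@le_trans _ _ (ln (2 * q))); first by rewrite ler_ln ?posrE ?mulr_gt0.
  by rewrite lnM ?posrE// lnq; have := ln2_le1; lra.
have ln2X j : ln (2 ^ j)%:R <= j%:R :> R.
  by rewrite natrX lnXn// -[_ *+ j]mulr_natl ler_piMr ?ln2_le1.
have lgn : (up_log 2 n)%:R <= 3 * L.
  by apply: le_trans (up_log_ln _) _; [exact: leq_trans n3|rewrite -/L; lra].
(* Rounding the number of buckets up to a power of two at most doubles it. *)
have Bk : (2 ^ up_log 2 (2 ^ j1 * k))%:R <= 4 * (2 ^ j1)%:R * q.
  apply: (@le_trans _ _ (2 * (2 ^ j1 * k)%:R)); last first.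
    rewrite natrM; have : 0 <= (2 ^ j1)%:R :> R by []; nra.
  have k1' : (0 < 2 ^ j1 * k)%N by rewrite muln_gt0 expn_gt0.
  have [k1|k1] := leqP (2 ^ j1 * k) 1.
    rewrite (_ : up_log 2 _ = 0)%N; last by apply/eqP; rewrite up_log_eq0 k1 orbT.
    by rewrite expn0 -natrM ler1n muln_gt0.
  rewrite -natrM ler_nat -[X in (2 ^ X)%N](@prednK (up_log _ _)) ?up_log_gt0//.
  by rewrite expnS leq_mul2l ltnW// up_log_gtn.
(* Quantities polynomial in [n] have logarithm [O(L)]; [A] collects the constants of the standing
   assumption. *)
have big (x : nat) : (0 < x)%N ->
    x%:R <= 3 * n%:R * (K1 * n%:R `^ c1) ^+ 2 -> (up_log 2 x)%:R <= A * L.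
  move=> x0 xle; apply: le_trans (up_log_ln x0) _.
  have pw : 0 < K1 * n%:R `^ c1 by rewrite mulr_gt0 ?powR_gt0//; lra.
  have : ln x%:R <= ln (3 * n%:R * (K1 * n%:R `^ c1) ^+ 2).
    by rewrite ler_ln// posrE ?ltr0n// (mulr_gt0 (mulr_gt0 _ n0) (exprn_gt0 2 pw)).
  have n30 : 0 < 3 * n%:R :> R by rewrite mulr_gt0.
  have pw2 : 0 < (K1 * n%:R `^ c1) ^+ 2 by rewrite exprn_gt0.
  rewrite lnM ?posrE// lnM ?posrE// lnXn//.
  rewrite lnM ?posrE ?powR_gt0//; last by lra.
  rewrite ln_powR -/L -[_ *+ 2]mulr_natl.
  have l3 : ln 3 <= 2 :> R by have := @le_ln1Dx R 2; apply; lra.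
  rewrite /A; nra.
have pow_le (y : R) : y <= K * n%:R `^ c' -> y <= K1 * n%:R `^ c1.
  move/le_trans; apply; apply: (@le_trans _ _ (K1 * n%:R `^ c')).
    by rewrite ler_wpM2r// powR_ge0.
  by rewrite ler_wpM2l ?ler_powR//; lra.
have {}mK := pow_le _ mK; have {}MK := pow_le _ MK.
set p := K1 * n%:R `^ c1 in big mK MK.
have m1 : 1 <= m%:R :> R by rewrite ler1n.
have p1 : 1 <= p by apply: le_trans mK.
have mM : (m * M)%:R <= p ^+ 2 :> R by rewrite natrM expr2 ler_pM.
have p2 : 1 <= p ^+ 2 by rewrite exprn_ege1.
have up1 : (up_log 2 (n * (m * M)).+1)%:R <= A * L.
  by apply: big => //; rewrite -natr1 natrM; nra.
have up2 : (up_log 2 (m * M).+2)%:R <= A * L.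
  by apply: big => //; rewrite -natr1 -natr1; nra.
have lnd := ln_dS d; rewrite -/D in lnd.
have d0 : 0 <= d%:R :> R by [].
(* Exponents range up to [d + O(log n)], so one costs [O(log d + log log n)] bits. *)
have upE : (up_log 2 (d + up_log 2 (n * (m * M)).+1).+1)%:R
    <= 1 + 2 * (D + 1 + ln (A + 1) + ln L).
  apply: le_trans (up_log_ln _) _ => //.
  suff : ln (d + up_log 2 (n * (m * M)).+1).+1%:R <=
      ln (d.+1%:R * ((A + 1) * L)).
    by rewrite lnM ?posrE ?mulr_gt0 ?lnM ?posrE//; lra.
  rewrite ler_ln ?posrE ?mulr_gt0//; [|lra|lra].
  rewrite -[(d + _).+1]addn1 -[d.+1]addn1 !natrD.
  move: up1 d0 => {}up1 {}d0; move: (up_log _ _)%:R up1 => U up1.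
  have h1 : 0 <= d%:R * (A * L) by rewrite !mulr_ge0//; lra.
  have h2 : 0 <= d%:R * (L - 1) by rewrite mulr_ge0//; lra.
  clear -up1 h1 h2 L1; lra.
(* The mantissa length brings in [log (1 / eps)] and a second [log d]. *)
have sle : s%:R <= 5 + 2 * j2%:R + 2 * D + 4 * e.
  rewrite sE; apply: le_trans (up_log_ln _) _; first by rewrite !muln_gt0 expn_gt0.
  rewrite natrM natrM lnM ?posrE ?mulr_gt0// lnM ?posrE//.
  by have := ln2X j2; lra.
have W : (up_log 2 (d + up_log 2 (n * (m * M)).+1).+1 + (s + 4))%:R <=
    (A2 / t0 + 4) * th.
  have : A2 <= A2 / t0 * th by rewrite -mulrA ler_peMr// mulrC ler_pdivlMr ?mul1r.
  by rewrite mulrDl !natrD /th /A2; lra.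
have qL : 0 <= q * L by rewrite mulr_ge0// ?ltW//; lra.
have one : 1 <= th / t0 by rewrite ler_pdivlMr// mul1r.
have part1 : (c2 * up_log 2 n * 2 ^ up_log 2 (2 ^ j1 * k)
       * (up_log 2 (d + up_log 2 (n * (m * M)).+1).+1 + (s + 4)))%:R <=
    c2%:R * (3 * L) * (4 * (2 ^ j1)%:R * q) * ((A2 / t0 + 4) * th).
  by rewrite 3!natrM !ler_pM// ?mulr_ge0// ler_wpM2l.
have part2 : (k * up_log 2 n + k * up_log 2 (m * M).+2)%:R <=
    2 * q * ((3 + A) * L).
  by rewrite -mulnDr natrM natrD ler_pM// mulrDl lerD.
(* The broadcast and the exact sums cost no factor [th]; it is supplied by [th / t0 >= 1]. *)
have part3 : 2 * q * ((3 + A) * L) <= 2 * (3 + A) / t0 * (q * L * th).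
  have -> : 2 * (3 + A) / t0 * (q * L * th) =
    2 * q * ((3 + A) * L) * (th / t0) by ring.
  rewrite ler_peMr// !mulr_ge0// ?ltW//; lra.
rewrite -addnA natrD mulrDl; apply: lerD; last exact: le_trans part2 part3.
by apply: le_trans part1 _; rewrite le_eqVlt; apply/orP; left; apply/eqP; ring.
Qed.

End BitCount.

Lemma rV_norm_le (R : realType) n (x : 'rV[R]_n) b :
  0 <= b -> (forall i, `|x 0 i| <= b) -> `|x| <= b.
Proof.
move=> b0 xb; rewrite [leLHS]mx_normrE; apply: bigmax_le => // -[i j] _ /=.
by rewrite (ord1 i).
Qed.

(** By induction: the cross term [2 * j * y * y] is at most [y] as long as [2 * j * y <= 1]. *)
Lemma compound_le (R : realFieldType) (y : R) (N : nat) :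
  0 <= y -> 2 * N%:R * y <= 1 -> (1 + y) ^+ N - 1 <= 2 * N%:R * y.
Proof.
move=> y0 Ny; suff H j : (j <= N)%N -> (1 + y) ^+ j <= 1 + 2 * j%:R * y.
  by rewrite lerBlDl H.
elim: j => [|j IH] jN; first by rewrite expr0 mulr0 mul0r addr0.
have {}IH := IH (ltnW jN).
have jy : 2 * j%:R * y <= 1.
  apply: le_trans Ny; rewrite ler_wpM2r// ler_wpM2l// ler_nat ltnW//.
have := ler_wpM2r y0 jy; rewrite exprSr -[j.+1]addn1 natrD.
have : (1 + y) ^+ j * (1 + y) <= (1 + 2 * j%:R * y) * (1 + y).
  by rewrite ler_wpM2r// addr_ge0.
lra.
Qed.

Lemma prob_bits_ge (R : realType) r (I : finType) (A : pred (r.-tuple bool))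
    (fail : I -> r.-tuple bool -> bool) (p : R) :
  (forall w, (forall i, ~~ fail i w) -> A w) ->
  \sum_i mean (fun w => (fail i w)%:R) <= p -> 1 - p <= prob_bits R A.
Proof.
move=> HA le_p; apply: (@le_trans _ _ (mean (fun w => (A w)%:R))); last first.
  by rewrite mean_indicator /prob_bits card_tuple card_bool.
rewrite lerBlDl; apply: (le_trans _ (lerD le_p (lexx _))).
rewrite -mean_sum -meanD -[leLHS](@mean_cst R (r.-tuple bool) 1); last first.
  by rewrite card_tuple card_bool expn_gt0.
apply: mean_le => w; have [Aw|nAw] := boolP (A w).
  by rewrite lerDr sumr_ge0.
have /existsP[i fi] : [exists i, fail i w].
  by apply: contraNT nAw; rewrite negb_exists => /forallP; exact: HA.
by rewrite addr0 (bigD1 i)//= fi lerDl sumr_ge0.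
Qed.

Lemma leq_expl (a c j : nat) : (a <= c)%N -> (a ^ j <= c ^ j)%N.
Proof. by case: j => [|j] ac; rewrite ?expn0 ?leq_exp2r. Qed.

(** * The sketching protocol *)

Section SketchProtocol.
Variables (R : realType) (V : finType) (n : nat) (e : rel V).
Variables (root : V) (par : V -> V) (dep : V -> nat) (d : nat).
Hypothesis sym_e : symmetric e.
Hypothesis e_par : forall v, v != root -> e v (par v).
Hypothesis dep_par : forall v, v != root -> dep v = (dep (par v)).+1.
Hypothesis dep_le : forall v, (dep v <= d)%N.
Hypothesis dep_root : dep root = 0%N.
Variables (k rows b s E N M : nat) (eps : R) (i0 : 'I_n).

Local Notation child := (child root par).
Local Notation B := 'I_(2 ^ b).
Local Notation C := 'I_(2 ^ E).

(** A hash, random signs and one rounding seed per player. The buckets of a row may share rounding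
    seeds, since an estimate reads only one bucket per row. *)
Let row_seed : finType :=
  ({ffun 'I_n -> B} * {ffun 'I_n -> bool} * {ffun V -> C})%type.
Let Omega : finType := {ffun 'I_rows -> row_seed}.
Let F1 : finType := {ffun 'I_rows * B -> float s E}.
Let F2 : finType := {ffun 'I_k -> 'I_n}.
Let F3 : finType := {ffun 'I_k -> 'I_N.+2}.

Let bucket_round (w : row_seed) (y : B) v (x : 'rV[nat]_n) (m : V -> float s E) :=
  float_round s (bucket_sketch w.1.2 [pred j | w.1.1 j == y] (fun=> x 0) v
    + \sum_(c | child v c) float_val (m c)) (w.2 v).

Let sketch_step (om : Omega) v x (m : V -> F1) : F1 :=
  [ffun ry => bucket_round (om ry.1) ry.2 v x (fun c => m c ry)].

Let estimate (om : Omega) (f : F1) (i : 'I_n) : int :=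
  median [seq sgb ((om r).1.2 i) * float_val (f (r, (om r).1.1 i))
    | r <- enum 'I_rows].

(** For [k > n] the list is padded with [i0]; this does no harm, as the exact sum of [i0] is then
    returned too. *)
Let candidates (om : Omega) (f : F1) : F2 :=
  [ffun l : 'I_k => nth i0 (largest k (estimate om f)) l].

(* Sums modulo N + 2, exact because the true sums are at most N. *)
Let exact_step (H : F2) v (x : 'rV[nat]_n) (m : V -> F3) : F3 :=
  [ffun l => (x 0 (H l))%:R + \sum_(c | child v c) m c l].

Let combine (om : Omega) (f : F1) (a : F3) : 'rV[R]_n :=
  \row_i (if [pick l | candidates om f l == i] is Some l then (a l : nat)%:R
          else (estimate om f i)%:~R).

Let card_Omega : #|Omega| = (2 ^ ((b * n + n + E * #|V|) * rows))%N.
Proof.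
rewrite card_ffun card_ord !card_prod !card_ffun !card_ord card_bool.
by rewrite -!expnM -!expnD -expnM.
Qed.

Let card_F1 : (#|F1| <= 2 ^ (rows * 2 ^ b * (up_log 2 E.+1 + (s + 4))))%N.
Proof.
rewrite (mulnC (rows * _)%N) expnM card_ffun.
have -> : #|{: 'I_rows * B}| = (rows * 2 ^ b)%N by rewrite card_prod !card_ord.
apply: leq_expl; apply: leq_trans (card_float s E) _.
by rewrite [leqRHS]expnD leq_mul// up_logP.
Qed.

Let card_F2 : (#|F2| <= 2 ^ (k * up_log 2 n))%N.
Proof.
by rewrite (mulnC k) expnM card_ffun !card_ord leq_expl ?up_logP.
Qed.

Let card_F3 : (#|F3| <= 2 ^ (k * up_log 2 N.+2))%N.
Proof.
by rewrite (mulnC k) expnM card_ffun !card_ord leq_expl ?up_logP.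
Qed.


Hypothesis eps01 : 0 < eps < 1.
Hypothesis eps_k : eps ^- 2 <= k%:R.
Hypothesis b_large : 2048 * k%:R <= (2 ^ b)%:R :> R.
Hypothesis s_large : 128 * (d.+1%:R * k%:R) <= (2 ^ s)%:R :> R.
Hypothesis E_large : (2 ^ d * (n * (#|V| * M)) < 2 ^ E)%N.
Hypothesis N_large : (#|V| * M <= N)%N.

Let rd (z : int) (q : C) : int := float_val (float_round s z q).
Let Zmax := (2 ^ d * (n * (#|V| * M)))%N.

Let Zmax_lt z : (`|z| <= Zmax)%N -> (`|z| < 2 ^ E)%N.
Proof. by move=> /leq_ltn_trans; apply. Qed.

Let rd_err z q : (`|z| <= Zmax)%N ->
  `|rd z q - z|%:~R <= (2 ^ s)%:R^-1 * `|z|%:~R :> R.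
Proof.
move=> /Zmax_lt zE; rewrite ler_pdivlMl ?ltr0n ?expn_gt0// mulrC.
have := float_round_err s q zE; rewrite -(ler_int R) intrM.
by rewrite [((2 ^ s)%N%:Z)%:~R]/((2 ^ s)%N%:R).
Qed.

Let rd_le2 z q : (`|z| <= Zmax)%N -> (`|rd z q| <= 2 * `|z|)%N.
Proof.
move=> /Zmax_lt zE; have := float_round_err s q zE; rewrite -/(rd z q).
have : 1 <= (2 ^ s)%N%:Z :> int by rewrite lez_nat expn_gt0.
move: (2 ^ s)%N%:Z (rd z q) => y u y1.
have : `|u| <= `|u - z| + `|z| by rewrite -{1}(subrK z u) ler_normD.
have : `|u - z| <= `|u - z| * y by rewrite ler_peMr.
lia.
Qed.

Let rd_mean0 z : (`|z| <= Zmax)%N -> \sum_q (rd z q - z) = 0.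
Proof. by move=> /Zmax_lt; exact: float_round_mean0. Qed.

Section Inputs.
Variables (X : V -> 'rV[nat]_n) (xs : V -> 'I_n -> nat).
Hypothesis XM : forall v j, (X v 0%R j <= M)%N.
Hypothesis xsE : forall v j, (xs v j = X v 0%R j + \sum_(c | child v c) xs c j)%N.

Let x (i : 'I_n) : R := (xs root i)%:R.

Let xs_root i : xs root i = (\sum_v X v 0%R i)%N.
Proof.
have [//] : Posz (xs root i) = Posz (\sum_v X v 0%R i)%N.
rewrite (big_morph Posz PoszD erefl).
apply: (@tree_sum V root par int
  (fun v => Posz (X v 0 i)) (fun v => Posz (xs v i))).
by move=> v; rewrite xsE PoszD (big_morph Posz PoszD erefl).
Qed.

Let xs_root_le i : (xs root i <= #|V| * M)%N.
Proof.
by rewrite xs_root -sum_nat_const; apply: leq_sum => v _; exact: XM.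
Qed.

Let total_inputE i : total_input R X 0 i = x i.
Proof. by rewrite mxE /x xs_root summxE. Qed.

Let t : R := l2norm (tail k (total_input R X)).

Let heavy : pred 'I_n := [pred j | j \in largest k x].

Let tailE j : tail k (total_input R X) 0 j = if heavy j then 0 else x j.
Proof.
have xE : (fun j => `|total_input R X 0 j|) = x.
  by apply/funext => i; rewrite total_inputE ger0_norm.
rewrite mxE total_inputE /heavy /= -xE; reflexivity.
Qed.

Let t_sqr : t ^+ 2 = \sum_(j | ~~ heavy j) x j ^+ 2.
Proof.
rewrite /t /l2norm sqr_sqrtr; last by apply: sumr_ge0 => j _; exact: sqr_ge0.
rewrite [RHS]big_mkcond/=; apply: eq_bigr => j _; rewrite tailE.
by case: (heavy j); rewrite ?expr0n.
Qed.

Let t_ge0 : 0 <= t. Proof. exact: sqrtr_ge0. Qed.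

Let light_le i : i \notin largest k x -> x i <= t.
Proof.
move=> hi; rewrite -(@ler_pXn2r _ 2)// ?nnegrE// t_sqr (bigD1 i)//= lerDl.
by apply: sumr_ge0 => j _; exact: sqr_ge0.
Qed.

(** Dropping the cross term of the squared target error leaves the shape of the variance bound,
    linear in [t ^ 2] and [x i ^ 2]. *)
Let theta i : R := (eps / 4 * t) ^+ 2 + (eps / 8 * x i) ^+ 2.

Let k_gt0 : 0 < k%:R :> R.
Proof.
have /andP[e0 _] := eps01; apply: lt_le_trans eps_k.
by rewrite invr_gt0 exprn_gt0.
Qed.

Let k_inv : k%:R^-1 <= eps ^+ 2.
Proof.
have /andP[e0 _] := eps01.
by rewrite invf_ple ?posrE ?exprn_gt0.
Qed.

(** From [g <= 1 / (128 * d.+1 * k)], compounding over [d.+1] levels costs at most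
    [2 * d.+1 * g ^ 2 <= 1 / (8192 * k)]. *)
Let rate_le : (1 + (2 ^ s)%:R^-1 ^+ 2) ^+ d.+1 - 1 <= eps ^+ 2 / 128 / 64 :> R.
Proof.
set g : R := (2 ^ s)%:R^-1.
have S0 : 0 < (2 ^ s)%:R :> R by rewrite ltr0n expn_gt0.
have g0 : 0 < g by rewrite invr_gt0.
have d0 : 0 < d.+1%:R :> R by rewrite ltr0n.
have k1 : 1 <= k%:R :> R by move: k_gt0; rewrite ltr0n -(ler1n R).
have d1 : 1 <= d.+1%:R :> R by rewrite ler1n.
have dg : 128 * d.+1%:R * g <= k%:R^-1.
  rewrite ler_pdivrMr// ler_pdivlMl//; apply: le_trans s_large.
  by rewrite mulrC -mulrA.
have g1 : 128 * g <= 1.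
  rewrite ler_pdivrMr// mul1r; apply: le_trans s_large.
  by rewrite ler_peMr// mulr_ege1.
have gg : 128 * g ^+ 2 <= g by rewrite expr2 mulrA ler_piMl// ltW.
have dgg : 2 * d.+1%:R * g ^+ 2 <= eps ^+ 2 / 128 / 64.
  have : d.+1%:R * (128 * g ^+ 2) <= d.+1%:R * g by rewrite ler_wpM2l// ltW.
  have := k_inv; lra.
apply: (le_trans _ dgg); apply: compound_le; first exact: sqr_ge0.
apply: le_trans dgg _; have /andP[e0 e1] := eps01.
have : eps ^+ 2 <= 1 by rewrite exprn_ile1// ltW.
lra.
Qed.

Section Seeds.
Variable sol : row_seed * B -> V -> float s E.
Hypothesis solE : forall p v, sol p v = bucket_round p.1 p.2 v (X v) (sol p).

Let Y h sg u y v : int := float_val (sol (h, sg, u, y) v).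

Let bad i (w : row_seed) : bool :=
  theta i < ((row_estimate root i Y w)%:~R - x i) ^+ 2.

Let bad_mean i : mean (fun w => (bad i w)%:R) <= 15^-1 :> R.
Proof.
apply: (@row_failure R V root par dep d dep_par dep_le dep_root C (2 ^ s)%:R^-1 rd
  Zmax _ rd_le2 rd_mean0 rd_err 'I_n (fun v => X v 0) xs xsE _ B heavy i Y) => //.
- by rewrite card_ord expn_gt0.
- rewrite leq_pmul2l ?expn_gt0//.
  apply: leq_trans (_ : \sum_(j < n) #|V| * M <= _)%N.
    by apply: leq_sum => j _; exact: xs_root_le.
  by rewrite sum_nat_const card_ord.
- by rewrite card_ord expn_gt0.
- by move=> h sg u y v; rewrite /Y solE.
- have -> : #|heavy| = size (largest k x).
    by rewrite -(card_uniqP (largest_uniq k x)); apply: eq_card.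
  rewrite size_largest card_ord -(ler_nat R) natrM; apply: le_trans b_large.
  apply: (@le_trans _ _ (20 * k%:R)); last by have := k_gt0; lra.
  by rewrite ler_wpM2l// ler_nat geq_minl.
have /andP[e0 e1] := eps01.
have e2 : eps ^+ 2 <= 1 by rewrite exprn_ile1// ltW.
rewrite -t_sqr card_ord /theta.
have iB : (2 ^ b)%:R^-1 <= eps ^+ 2 / 2048 :> R.
  apply: (@le_trans _ _ (2048 * k%:R)^-1).
    have B0 : 0 < (2 ^ b)%:R :> R by rewrite ltr0n expn_gt0.
    have K0 : 0 < 2048 * k%:R :> R by have := k_gt0; lra.
    by rewrite lef_pV2 ?posrE//; exact: b_large.
  by rewrite invfM; have := k_inv; lra.
move: rate_le; set r := _ - 1 => rle.
have r0 : 0 <= r by rewrite subr_ge0 exprn_ege1// lerDl sqr_ge0.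
have r1 : r <= 100^-1 by lra.
have WB : t ^+ 2 / (2 ^ b)%:R <= t ^+ 2 * (eps ^+ 2 / 2048).
  by rewrite ler_wpM2l// sqr_ge0.
have WB0 : 0 <= t ^+ 2 / (2 ^ b)%:R by rewrite divr_ge0// sqr_ge0.
have rW : r * (t ^+ 2 / (2 ^ b)%:R) <= 100^-1 * (t ^+ 2 / (2 ^ b)%:R).
  by rewrite ler_wpM2r.
have rx : r * x i ^+ 2 <= eps ^+ 2 / 128 / 64 * x i ^+ 2.
  by rewrite ler_wpM2r// sqr_ge0.
have P1 : 0 <= eps ^+ 2 * t ^+ 2 by rewrite mulr_ge0// sqr_ge0.
have P2 : 0 <= eps ^+ 2 * x i ^+ 2 by rewrite mulr_ge0// sqr_ge0.
move: (t ^+ 2 / _) WB WB0 rW => W WB WB0 rW.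
(* The claim is [120 * W + 120 * r * (x i ^ 2 + W) <= theta i]; it holds as
   [120 * (1 + 1/100) / 2048 < 1/16] and [120 / 8192 < 1/64]. *)
rewrite !exprMn; lra.
Qed.

Section Messages.
Variables (om : Omega) (m1 : V -> F1) (m3 : V -> F3).
Hypothesis m1E : forall v, m1 v = sketch_step om v (X v) m1.
Hypothesis m3E : forall v, m3 v = exact_step (candidates om (m1 root)) v (X v) m3.

(** By uniqueness of tree recursions, the messages of a run depend, row by row, on the seed of that
    row alone. Hence the rows fail independently. *)
Let m1_sol v r y : m1 v (r, y) = sol (om r, y) v.
Proof.
move: v; apply: (@tree_uniq _ root par dep d dep_par dep_le _
  (fun v m => bucket_round (om r) y v (X v) m) (fun v => m1 v (r, y))).
- move=> v m m' mm'; rewrite /bucket_round; congr (float_round _ (_ + _) _).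
  by apply: eq_bigr => c vc; rewrite mm'.
- by move=> v; rewrite [in LHS]m1E ffunE.
- by move=> v; rewrite solE.
Qed.

(** The integers within the error bound form an interval, so the median lies in it once most rows
    do. *)
Let estimate_err i : (2 * #|[pred r | bad i (om r)]| < rows)%N ->
  `|(estimate om (m1 root) i)%:~R - x i| <= eps / 4 * t + eps / 8 * x i.
Proof.
move=> few_bad; have /andP[e0 e1] := eps01.
have a0 : 0 <= eps / 4 * t by rewrite mulr_ge0// ltW// divr_gt0.
have b0 : 0 <= eps / 8 * x i by rewrite mulr_ge0// ltW// divr_gt0.
rewrite -(@ler_pXn2r _ 2)// ?nnegrE ?addr_ge0// real_normK ?num_real//.
apply: (@le_trans _ _ (theta i)); last first.
  by rewrite /theta sqrrD lerD2r lerDl mulrn_wge0// mulr_ge0.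
apply: (@median_majority (fun z => (z%:~R - x i) ^+ 2 <= theta i)).
  move=> a b' c ab bc Pa Pc.
  have : (a%:~R : R) <= b'%:~R by rewrite ler_int.
  have : (b'%:~R : R) <= c%:~R by rewrite ler_int.
  move=> bc' ab'; have [bx|xb] := leP (b'%:~R) (x i).
    by apply: le_trans Pa; nra.
  by apply: le_trans Pc; nra.
rewrite size_map size_enum_ord; apply: leq_ltn_trans few_bad.
rewrite leq_mul2l/= count_map -size_filter cardE enumT /enum_mem.
rewrite eq_leq//; congr size; apply: eq_in_filter => r _ /=.
rewrite -ltNge m1_sol inE /bad /row_estimate /Y.
by case: (om r) => [[h sg] u].
Qed.

Let exact_root l :
  (m3 root l : nat) = xs root (candidates om (m1 root) l).
Proof.
pose H := candidates om (m1 root); rewrite -/H.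
have -> : m3 root l = \sum_v (X v 0 (H l))%:R.
  apply: (@tree_sum V root par _ (fun v => (X v 0 (H l))%:R) (fun v => m3 v l)).
  by move=> v; rewrite [in LHS]m3E ffunE -/H.
rewrite -natr_sum -xs_root Zp_nat /= modn_small// ltnS ltnW// ltnS.
exact: leq_trans (xs_root_le _) N_large.
Qed.

Lemma combine_err :
  (forall i, ~~ (rows <= 2 * #|[pred r | bad i (om r)]|)%N) ->
  `|combine om (m1 root) (m3 root) - total_input R X| <= eps * t.
Proof.
move=> good; have /andP[e0 e1] := eps01.
have et0 : 0 <= eps * t by rewrite mulr_ge0// ltW.
have est_ok i :
    `|(estimate om (m1 root) i)%:~R - x i| <= eps / 4 * t + eps / 8 * x i.
  by apply: estimate_err; rewrite ltnNge.
apply: rV_norm_le => // i.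
have -> : (combine om (m1 root) (m3 root) - total_input R X) 0 i =
    combine om (m1 root) (m3 root) 0 i - x i by rewrite -total_inputE !mxE.
rewrite mxE; case: pickP => [l /eqP lE|no_l].
  by rewrite exact_root lE subrr normr0.
apply: (@heavy_recovery R n k x (estimate om (m1 root)) t eps) => //.
apply/negP => il; set L := largest _ _ in il.
have lk : (index i L < k)%N.
  by apply: leq_trans (_ : size L <= k)%N;
    rewrite ?index_mem// size_largest geq_minl.
by have /negP := no_l (Ordinal lk); apply; rewrite ffunE /= nth_index.
Qed.

End Messages.

Lemma sketch_correct_of_solution : exists fail : 'I_n -> Omega -> bool,
  (forall i, mean (fun om => (fail i om)%:R) <= 2 ^- rows :> R) /\
  forall om m1 m3, (forall v, m1 v = sketch_step om v (X v) m1) ->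
    (forall v, m3 v = exact_step (candidates om (m1 root)) v (X v) m3) ->
    (forall i, ~~ fail i om) ->
    `|combine om (m1 root) (m3 root) - total_input R X| <= eps * t.
Proof.
exists (fun i (om : Omega) => rows <= 2 * #|[pred r | bad i (om r)]|)%N; split.
  by move=> i; exact/majority_fails/bad_mean.
by move=> om m1 m3 m1E m3E; exact: combine_err.
Qed.

End Seeds.

Lemma sketch_correct : exists fail : 'I_n -> Omega -> bool,
  (forall i, mean (fun om => (fail i om)%:R) <= 2 ^- rows :> R) /\
  forall om m1 m3, (forall v, m1 v = sketch_step om v (X v) m1) ->
    (forall v, m3 v = exact_step (candidates om (m1 root)) v (X v) m3) ->
    (forall i, ~~ fail i om) ->
    `|combine om (m1 root) (m3 root) - total_input R X| <= eps * t.
Proof.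
have round_local (p : row_seed * B) v (m m' : V -> float s E) :
    (forall c, child v c -> m c = m' c) ->
    bucket_round p.1 p.2 v (X v) m = bucket_round p.1 p.2 v (X v) m'.
  move=> mm'; rewrite /bucket_round; congr (float_round _ (_ + _) _).
  by apply: eq_bigr => c vc; rewrite mm'.
have [sol solE] := choice (fun p => tree_fix dep_par dep_le
  (fun _ => (ord0, ord0)) (round_local p)).
exact: (sketch_correct_of_solution solE).
Qed.

End Inputs.

Lemma sketch_protocol : exists (P : protocol R V n) (T : nat),
  forall X : V -> 'rV[nat]_n, (forall v j, (X v 0%R j <= M)%N) ->
  let cost := (rows * 2 ^ b * (up_log 2 E.+1 + (s + 4)) + k * up_log 2 n
    + k * up_log 2 N.+2)%N in
  [/\ forall w, terminated e P X w T,
      1 - n%:R * 2 ^- rows <=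
        prob_bits R (fun w => `|result e P X w T root - total_input R X| <=
          eps * l2norm (tail k (total_input R X))),
      forall w, (total_comm e P X w T <= #|V| * cost)%N &
      forall w, (max_comm e P X w T <= cost)%N].
Proof.
have sketch_local om v x m m' : (forall c, child v c -> m c = m' c) ->
    sketch_step om v x m = sketch_step om v x m'.
  move=> mm'; apply/ffunP => ry; rewrite !ffunE; congr (float_round _ (_ + _) _).
  by apply: eq_bigr => c vc; rewrite mm'.
have exact_local H v x m m' : (forall c, child v c -> m c = m' c) ->
    exact_step H v x m = exact_step H v x m'.
  move=> mm'; apply/ffunP => l; rewrite !ffunE; congr (_ + _).
  by apply: eq_bigr => c vc; rewrite mm'.
have [P [T [rho [rho_bij PT]]]] := @tree_protocol R V n e root par dep d sym_e
  e_par dep_par dep_le Omega F1 F2 F3 _ _ _ _ card_Omega card_F1 card_F2 card_F3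
  [ffun=> (ord0, ord0)] [ffun=> i0] [ffun=> ord0]
  sketch_step candidates exact_step combine sketch_local exact_local.
exists P, T => X XM cost; split.
- by move=> w; have [] := PT X w.
- pose add_children v (m : V -> 'I_n -> nat) (j : 'I_n) :=
    (X v 0%R j + \sum_(c | child v c) m c j)%N.
  have add_local v m m' : (forall c, child v c -> m c = m' c) ->
      add_children v m = add_children v m'.
    move=> mm'; apply/funext => j; congr (_ + _)%N.
    by apply: eq_bigr => c vc; rewrite mm'.
  have [xs xsE] := tree_fix dep_par dep_le (fun _ _ => 0%N) add_local.
  have [fail [fail_mean fail_ok]] := @sketch_correct X xs XM
    (fun v j => congr1 (fun f => f j) (xsE v)).
  (* Union bound over the [n] coordinates. *)
  apply: (@prob_bits_ge _ _ _ _ (fun i w => fail i (rho w))).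
    move=> w /fail_ok ok; have [_ [m1 [m3 [m1E m3E ->]]] _ _] := PT X w.
    exact: ok m1E m3E.
  apply: (@le_trans _ _ (\sum_(i < n) 2 ^- rows)).
    by apply: ler_sum => i _; rewrite (mean_bij (fun om => (fail i om)%:R) rho_bij).
  by rewrite sumr_const card_ord mulr_natl.
- by move=> w; have [_ _ c1 _] := PT X w.
- by move=> w; have [_ _ _ c1] := PT X w.
Qed.

End SketchProtocol.

(** * Choice of the parameters *)

Lemma ceil_sqr_bounds (R : realType) (eps : R) : 0 < eps < 1 ->
  let k := `|Num.ceil (eps ^- 2)|%N in
  [/\ (0 < k)%N, eps ^- 2 <= k%:R & k%:R <= 2 * eps ^- 2].
Proof.
move=> /andP[e0 e1] k.
have q1 : 1 < eps ^- 2 by rewrite invf_gt1 ?exprn_gt0// exprn_ilt1// ltW.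
have /andP[lo hi] := real_ceil_itv (num_real (eps ^- 2)).
have kE : k%:R = (Num.ceil (eps ^- 2))%:~R :> R.
  rewrite /k natr_absz ger0_norm//.
  by rewrite -(ler_int R) (le_trans _ hi)// (le_trans _ (ltW q1)).
rewrite -kE in hi; split=> //.
  by rewrite -(ltr_nat R) (lt_le_trans _ hi)// (lt_trans _ q1).
(* The ceiling adds less than 1, and [1 < eps ^- 2]. *)
by move: lo; rewrite rmorphB /= -kE; lra.
Qed.

(* c' and K are the constants in the standing assumption m, M = O(n^c').
   The condition 3 <= n makes log log n positive. The norm `|_| on row
   vectors is the maximum norm. *)
Theorem theorem13 (R : realType) (c c' K : R) (hc : 1 <= c) :
  exists2 C : R, 0 < C &
  forall (n : nat) (V : finType) (e : rel V) (root : V) (M : nat) (eps : R),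
    (3 <= n)%N ->
    simple_graph e -> connected_graph e ->
    0 < eps < 1 ->
    #|V|%:R <= K * n%:R `^ c' -> M%:R <= K * n%:R `^ c' ->
    exists (P : protocol R V n) (T : nat),
    forall X : V -> 'rV[nat]_n, (forall v j, (X v 0%R j <= M)%N) ->
      [/\ forall w, terminated e P X w T,
          1 - n%:R `^ (- c) <=
            prob_bits R (fun w =>
              `|result e P X w T root - total_input R X| <=
              eps * l2norm (tail `|Num.ceil (eps ^- 2)|%N (total_input R X))),
          forall w,
            (total_comm e P X w T)%:R <=
              C * (#|V|%:R * edge_bound n (diameter e) eps) &
          forall w,
            (max_comm e P X w T)%:R <= C * edge_bound n (diameter e) eps].
Proof.
(* With [c2 * up_log 2 n] rows a coordinate fails with probability at most [n ^ -(c + 1)]; the union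
   bound loses a factor [n]. *)
have [c2 c2_ge] : exists c2 : nat, c + 1 <= c2%:R.
  exists (Num.bound (c + 1)); apply: ltW; apply: archi_boundP; lra.
have [j1 j1_ge] : exists j, 2048 <= (2 ^ j)%:R :> R.
  by exists 11; rewrite natrX; lra.
have [j2 j2_ge] : exists j, 128 <= (2 ^ j)%:R :> R by exists 7; rewrite natrX; lra.
have [C C0 bits] := bit_count c' K c2 j1 j2.
exists C => // n V e root M eps n3 [sym_e _] con_e eps01 VK MK.
have [par parP] := bfs_tree root sym_e con_e.
have V0 : (0 < #|V|)%N by apply/card_gt0P; exists root.
have [k0 k_lo k_hi] := ceil_sqr_bounds eps01; set k := `|_|%N in k0 k_lo k_hi *.
pose d := diameter e; pose s := up_log 2 (2 ^ j2 * (d.+1 * k)).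
have n0 : (0 < n)%N by apply: leq_trans n3.
have k0R : 0 <= k%:R :> R by [].
have b_large : 2048 * k%:R <= (2 ^ up_log 2 (2 ^ j1 * k))%:R :> R.
  apply: (@le_trans _ _ (2 ^ j1 * k)%:R); first by rewrite natrM ler_wpM2r.
  by rewrite ler_nat up_logP.
have s_large : 128 * (d.+1%:R * k%:R) <= (2 ^ s)%:R :> R.
  apply: (@le_trans _ _ (2 ^ j2 * (d.+1 * k))%:R); last by rewrite ler_nat up_logP.
  by rewrite natrM -natrM ler_wpM2r.
(* The summand [d] of the exponent range allows for one doubling per level of the tree. *)
have E_large : (2 ^ d * (n * (#|V| * M)) <
    2 ^ (d + up_log 2 (n * (#|V| * M)).+1))%N.
  by rewrite expnD ltn_pmul2l ?expn_gt0// up_logP.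
have [P [T PT]] := @sketch_protocol R V n e root par (gdist e root) d sym_e
  (fun v vr => (parP v vr).1) (fun v vr => (parP v vr).2)
  (gdist_diameter e root) (gdistxx e root)
  k (c2 * up_log 2 n) (up_log 2 (2 ^ j1 * k)) s (d + up_log 2 (n * (#|V| * M)).+1)
  (#|V| * M) M eps (Ordinal n0) eps01 k_lo b_large s_large E_large (leqnn _).
exists P, T => X XM; have [Pt Pp Ptot Pmax] := PT X XM.
have cost_le := bits n d #|V| M k s eps n3 V0 eps01 VK MK k0 k_hi erefl.
split=> //.
- apply: le_trans Pp; rewrite lerD2l lerN2.
  have nR : 0 < n%:R :> R by rewrite ltr0n.
  apply: (@le_trans _ _ (n%:R * n%:R `^ (- (c + 1)))).
    rewrite ler_wpM2l// powRN lef_pV2 ?posrE ?exprn_gt0 ?powR_gt0//.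
    apply: (@le_trans _ _ (n%:R ^+ c2)).
      by rewrite -powR_mulrn ?ler0n// ler_powR// ler1n.
    by rewrite -!natrX ler_nat [in leqRHS]mulnC expnM leq_expl// up_logP.
  rewrite -{1}(powRr1 (ltW nR)) -powRD; last by rewrite (gt_eqF nR) implybT.
  by rewrite le_eqVlt; apply/orP; left; apply/eqP; congr (_ `^ _); ring.
- move=> w; rewrite mulrCA; apply: le_trans (_ : (#|V| * _)%N%:R <= _).
    by rewrite ler_nat; exact: Ptot.
  by rewrite natrM ler_wpM2l.
- by move=> w; apply: le_trans cost_le; rewrite ler_nat; exact: Pmax.
Qed.
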